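(* Let $d,n$ be positive integers. Let $L_n^d$ be the poset, ordered by inclusion, of the $d$-torsion classes of the $d$-cluster tilting subcategory $\mathcal M_n^d$ of the higher Auslander algebra $A_n^d$ of type $\mathbb A$, each $d$-torsion class $\mathcal U$ being identified with the subset $\{x\in os_n^{d+1}\mid M_x\in\mathcal U\}$ of $os_n^{d+1}$. Let $\phi$ be the chain in $(os_n^d,\le_{prod})$ defined by $\phi(k)=(k,k,\dots,k)$ for $0\le k<n$. Then $$L_n^d=\mathrm{Tam}\big((os_n^d,\le_{prod}),\phi\big),$$ where an element $((x_1,\dots,x_d),k)$ of $\mathcal C_{os_n^d}^{\phi}$ is identified with $(x_1,\dots,x_d,k)\in os_n^{d+1}$. In other words, a subset of $os_n^{d+1}$ corresponds to a $d$-torsion class if and only if it is torclosed.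
   Context: Combinatorics. $os_n^d$ is the set of non-decreasing sequences of length $d$ with entries in $\{0,1,\dots,n-1\}$, with the product (componentwise) order $\le_{prod}$. $(P,\phi)$-Tamari lattices. Let $P$ be a finite poset with minimum $\hat 0$ and $\phi:\phi(0)=\hat 0<\dots<\phi(n-1)$ a chain in $P$. Put $I_P(x)=\{y\in P\mid y\le x\}$, $\mathcal C_k:=I_P(\phi(k))\times\{k\}$ for $0\le k<n$, and $\mathcal C_P^\phi:=\bigsqcup_{k<n}\mathcal C_k$ (disjoint union of posets: $(x,i)\le(y,j)$ iff $i=j$ and $x\le y$). An order filter (up-closed subset) $F$ of $\mathcal C_P^\phi$ is torclosed if for all $i<j<n$: $(x,i)\in F$ and $(\phi(i+1),j)\in F$ imply $(x,j)\in F$. $\mathrm{Tam}(P,\phi)$ is the lattice of torclosed subsets of $\mathcal C_P^\phi$ ordered by inclusion. Higher Auslander algebras of type $\mathbb A$. Let $K$ be a field. $A_n^d$ is the algebra of the quiver with vertex set $os_n^d$ and an arrow $y\to y-e_i$ whenever $y,y-e_i\in os_n^d$ ($e_i$ the $i$-th unit vector), modulo the relations: whenever $i\neq j$ and $y,\,y-e_i-e_j\in os_n^d$, the paths $y\to y-e_i\to y-e_i-e_j$ and $y\to y-e_j\to y-e_i-e_j$ are equal, a path through a sequence not in $os_n^d$ being read as $0$. Finite-dimensional modules are the finite-dimensional representations of this quiver satisfying these relations. For $x\in os_n^{d+1}$, $M_x$ is the representation with $K$ at each vertex $y$ such that $x_1\le y_1\le x_2\le y_2\le\dots\le x_d\le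 y_d\le x_{d+1}$, $0$ at the other vertices, and identity maps on all arrows between vertices carrying $K$. The subcategory $\mathcal M_n^d$ is the full subcategory of finite direct sums of copies of the $M_x$, $x\in os_n^{d+1}$; it is a $d$-cluster tilting subcategory of the category of finite-dimensional $A_n^d$-modules. $d$-torsion classes. A full subcategory $\mathcal U$ of a $d$-cluster tilting subcategory $\mathcal M$ (closed under isomorphisms, finite direct sums and direct summands) is a $d$-torsion class if for every $M\in\mathcal M$ there is an exact sequence $0\to U_M\to M\to V_1\to\dots\to V_d\to 0$ with all terms in $\mathcal M$ and $U_M\in\mathcal U$, such that for every $U\in\mathcal U$ the sequence $0\to\mathrm{Hom}(U,V_1)\to\dots\to\mathrm{Hom}(U,V_d)\to0$ is exact. *)

(* Defs.v *)
From HB Require Import structures.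
From mathcomp Require Import all_boot all_order all_algebra.
From mathcomp Require Import boolp.
Set Implicit Arguments.
Unset Strict Implicit.
Unset Printing Implicit Defensive.
Import Order.TTheory GRing.Theory.
Local Open Scope ring_scope.

Record os (n d : nat) : Type := Os {
  os_tuple : d.-tuple 'I_n;
  os_sorted : sorted (relpre val leq) os_tuple
}.

HB.instance Definition _ n d := [isSub for @os_tuple n d].
HB.instance Definition _ n d := [Finite of os n d by <:].

(* [x i] is the entry of index [i], with indices starting at 0. *)
Definition entry n d (x : os n d) (i : 'I_d) : 'I_n := tnth (os_tuple x) i.
Coercion entry : os >-> Funclass.

Lemma osP n d (x y : os n d) : (forall i, x i = y i :> nat) -> x = y.
Proof.
move=> exy; do 2!apply: val_inj; congr val; apply: eq_from_tnth => i.
by apply: val_inj; apply: exy.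
Qed.

Lemma sorted_tnthP n d (t : d.-tuple 'I_n) :
  reflect (forall i j : 'I_d, (i <= j)%N -> (tnth t i <= tnth t j)%N)
          (sorted (relpre val leq) t).
Proof.
apply: (iffP idP) => [st i j ij|h].
  pose x0 := tnth t i; rewrite (tnth_nth x0 t i) (tnth_nth x0 t j).
  apply: (sorted_leq_nth (leT := relpre val leq)) => //.
  - by move=> a b c /=; apply: leq_trans.
  - by move=> a /=.
  - by rewrite inE size_tuple.
  - by rewrite inE size_tuple.
case: d t h => [|d] t h; first by rewrite tuple0.
pose x0 := tnth t ord0; apply/(sortedP x0) => i; rewrite size_tuple => id.
have := h (Ordinal (ltnW id)) (Ordinal id) (leqnSn i).
by rewrite (tnth_nth x0 t (Ordinal _)) (tnth_nth x0 t (Ordinal id)).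
Qed.

Definition le_prod n d (x y : os n d) : bool := [forall i, (x i <= y i)%N].

Fact le_prod_refl n d : reflexive (@le_prod n d).
Proof. by move=> x; apply/forallP. Qed.

Fact le_prod_anti n d : antisymmetric (@le_prod n d).
Proof.
move=> x y /andP[/forallP xy /forallP yx]; apply: osP => i.
by apply/eqP; rewrite eqn_leq xy yx.
Qed.

Fact le_prod_trans n d : transitive (@le_prod n d).
Proof.
move=> y x z /forallP xy /forallP yz.
by apply/forallP => i; apply: leq_trans (yz i).
Qed.

HB.instance Definition _ n d :=
  Order.Le_isPOrder.Build (Order.seqprod_display Order.OrdinalOrder.ord_display)
    (os n d) (@le_prod_refl n d) (@le_prod_anti n d) (@le_prod_trans n d).


Record botchain disp (P : finPOrderType disp) (n : nat) := BotChain {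
  chain_fun :> 'I_n -> P;
  chain_bot : forall k : 'I_n, k = 0%N :> nat -> forall p : P, (chain_fun k <= p)%O;
  chain_lt : forall i j : 'I_n, (i < j)%N -> (chain_fun i < chain_fun j)%O
}.

Section Tamari.
Variables (disp : Order.disp_t) (P : finPOrderType disp) (n : nat).
Variable phi : botchain P n.

Definition cposet : Type := {p : P * 'I_n | (p.1 <= phi p.2)%O}.

HB.instance Definition _ := Finite.on cposet.

Definition le_cposet (a b : cposet) : bool :=
  ((val a).2 == (val b).2) && ((val a).1 <= (val b).1)%O.

Definition order_filter (F : {set cposet}) : Prop :=
  forall a b, a \in F -> le_cposet a b -> b \in F.

Definition torclosed (F : {set cposet}) : Prop :=
  order_filter F /\
  forall (i j k : 'I_n) (x : P) (a b c : cposet),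
    (i < j)%N -> k = i.+1 :> nat ->
    val a = (x, i) -> val b = (phi k, j) -> val c = (x, j) ->
    a \in F -> b \in F -> c \in F.

(* The lattice is this set of sets, ordered by inclusion. *)
Definition Tam : {set {set cposet}} := [set F | `[< torclosed F >]].

End Tamari.

Lemma diag_sorted n d (k : 'I_n) :
  sorted (relpre val leq) [tuple of nseq d k].
Proof.
apply/sorted_tnthP => i j _.
by rewrite !(tnth_nth k) !nth_nseq !ltn_ord.
Qed.

Definition diag_fun n d (k : 'I_n) : os n d := Os (diag_sorted d k).

Lemma diagE n d (k : 'I_n) (i : 'I_d) : diag_fun d k i = k.
Proof. by rewrite /entry (tnth_nth k) nth_nseq ltn_ord. Qed.

Lemma diag_bot n d (k : 'I_n) : k = 0%N :> nat ->
  forall x : os n d, (diag_fun d k <= x)%O.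
Proof. by move=> k0 x; apply/forallP => i; rewrite diagE k0. Qed.

Lemma diag_lt n d (d_gt0 : (0 < d)%N) (i j : 'I_n) : (i < j)%N ->
  (diag_fun d i < diag_fun d j)%O.
Proof.
move=> ij; rewrite lt_neqAle; apply/andP; split; last first.
  by apply/forallP => l; rewrite !diagE ltnW.
apply/eqP => /(congr1 (fun x : os n d => x (Ordinal d_gt0))).
by rewrite !diagE => eij; rewrite eij ltnn in ij.
Qed.

Definition diag n d (d_gt0 : (0 < d)%N) : botchain (os n d) n :=
  BotChain (@diag_bot n d) (diag_lt d_gt0).

Lemma extend_sorted n d (d_gt0 : (0 < d)%N) (c : cposet (diag n d_gt0)) :
  sorted (relpre val leq) [tuple of rcons (os_tuple (val c).1) (val c).2].
Proof.
case: c => -[x k] /= /forallP xk.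
have sx := sorted_tnthP _ (os_sorted x).
apply/sorted_tnthP => i j ij; rewrite !(tnth_nth k) /= !nth_rcons !size_tuple.
have xlek (l : 'I_d) : (nth k (os_tuple x) l <= k)%N.
  by have := xk l; rewrite diagE /entry (tnth_nth k).
have [jd|dj] := ltnP j d; last first.
  have -> : (if j == d :> nat then k else k) = k by case: ifP.
  case: ltnP => [id|di]; first exact: (xlek (Ordinal id)).
  by case: ifP.
have id := leq_ltn_trans ij jd; rewrite id.
by have := sx (Ordinal id) (Ordinal jd) ij; rewrite !(tnth_nth k).
Qed.

(* The identification of ((x_1, ..., x_d), k) with (x_1, ..., x_d, k). *)
Definition extend n d (d_gt0 : (0 < d)%N) (c : cposet (diag n d_gt0)) :
  os n d.+1 := Os (extend_sorted c).

(* [step i y z] means z = y - e_i. *)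
Definition step n d (i : 'I_d) (y z : os n d) : bool :=
  [forall j, (y j == z j + (j == i) :> nat)%N].

Definition arrow n d (y z : os n d) : bool := [exists i, step i y z].

(* The composite along y -> y - e_i -> y - e_i - e_j.  The sum has at most one
   term; it is empty, hence 0, if y - e_i is not in os, and also if w is not
   y - e_i - e_j. *)
Definition path2 (K : fieldType) n d (V : os n d -> vectType K)
    (f : forall y z, 'Hom(V y, V z)) (i j : 'I_d) (y w : os n d) :
    'Hom(V y, V w) :=
  \sum_(z | step i y z && step j z w) (f z w \o f y z)%VF.

(* To have maps between all pairs of vertices, the maps between vertices not
   joined by an arrow are put to 0. *)
Record rep (K : fieldType) (n d : nat) := Rep {
  rsp :> os n d -> vectType K;
  rmap : forall y z, 'Hom(rsp y, rsp z);
  rmap_arrow : forall y z, ~~ arrow y z -> rmap y z = 0;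
  rmap_rel : forall (i j : 'I_d) (y w : os n d), i != j ->
    path2 rmap i j y w = path2 rmap j i y w
}.

Section Category.
Variables (K : fieldType) (n d : nat).
Implicit Types V W X : rep K n d.

Record hom V W := Hom {
  hmap :> forall y, 'Hom(V y, W y);
  hmap_nat : forall y z, (hmap z \o rmap V y z = rmap W y z \o hmap y)%VF
}.

Lemma hid_nat V y z : (\1 \o rmap V y z = rmap V y z \o \1)%VF.
Proof. by rewrite comp_lfun1l comp_lfun1r. Qed.

Definition hid V : hom V V := Hom (@hid_nat V).

Lemma hcomp_nat V W X (g : hom W X) (f : hom V W) y z :
  ((g z \o f z) \o rmap V y z = rmap X y z \o (g y \o f y))%VF.
Proof. by rewrite -comp_lfunA hmap_nat comp_lfunA hmap_nat comp_lfunA. Qed.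

Definition hcomp V W X (g : hom W X) (f : hom V W) : hom V X :=
  Hom (@hcomp_nat V W X g f).

Lemma hzero_nat V W y z : (0 \o rmap V y z = rmap W y z \o 0)%VF.
Proof. by rewrite comp_lfun0l comp_lfun0r. Qed.

Definition hzero V W : hom V W := Hom (@hzero_nat V W).

Definition heq V W (f g : hom V W) : Prop := forall y, f y = g y.

Definition iso V W : Prop :=
  exists (f : hom V W) (g : hom W V),
    heq (hcomp g f) (hid V) /\ heq (hcomp f g) (hid W).

Definition mono V W (f : hom V W) : Prop := forall y, lker (f y) = 0%VS.

Definition exact_at V W X (f : hom V W) (g : hom W X) : Prop :=
  forall y, limg (f y) = lker (g y).

Lemma zero_rel (i j : 'I_d) (y w : os n d) : i != j ->
  path2 (fun _ _ => 0 : 'Hom('rV[K]_0, 'rV[K]_0)) i j y w =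
  path2 (fun _ _ => 0 : 'Hom('rV[K]_0, 'rV[K]_0)) j i y w.
Proof.
by move=> _; rewrite /path2 !big1 // => z _; rewrite comp_lfun0l.
Qed.

Definition rzero : rep K n d :=
  @Rep K n d (fun _ => 'rV[K]_0 : vectType K) (fun _ _ => 0)
    (fun _ _ _ => erefl) zero_rel.

End Category.

Section DirectSum.
Variable K : fieldType.

Section Pair.
Variables (A B A' B' : vectType K) (f : 'Hom(A, A')) (g : 'Hom(B, B')).

Definition pair_fun (v : A * B) : A' * B' := (f v.1, g v.2).

Fact pair_fun_is_linear : linear pair_fun.
Proof. by move=> a u v; rewrite /pair_fun /= !linearP. Qed.

HB.instance Definition _ :=
  GRing.isLinear.Build K (A * B)%type (A' * B')%type _ pair_fun
    pair_fun_is_linear.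

Definition lpair : 'Hom((A * B)%type, (A' * B')%type) := linfun pair_fun.

Lemma lpairE v : lpair v = (f v.1, g v.2).
Proof. by rewrite lfunE. Qed.

End Pair.

Variables (n d : nat) (V W : rep K n d).

Definition dsum_map y z : 'Hom((V y * W y)%type, (V z * W z)%type) :=
  lpair (rmap V y z) (rmap W y z).

Lemma dsum_arrow y z : ~~ arrow y z -> dsum_map y z = 0.
Proof.
move=> nyz; apply/lfunP => v; rewrite lpairE (rmap_arrow V nyz).
by rewrite (rmap_arrow W nyz) !lfunE.
Qed.

Lemma dsum_path2 i j y w :
  path2 (V := fun y => (V y * W y)%type) dsum_map i j y w =
  lpair (path2 (rmap V) i j y w) (path2 (rmap W) i j y w).
Proof.
apply/lfunP => v; rewrite lpairE /path2 !sum_lfunE.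
rewrite [RHS](_ : _ = \sum_(z | step i y z && step j z w)
  ((rmap V z w \o rmap V y z)%VF v.1, (rmap W z w \o rmap W y z)%VF v.2)).
  by apply: eq_bigr => z _; rewrite !comp_lfunE /= !lpairE.
rewrite [RHS]surjective_pairing.
by rewrite (raddf_sum fst) (raddf_sum snd).
Qed.

Lemma dsum_rel (i j : 'I_d) (y w : os n d) : i != j ->
  path2 (V := fun y => (V y * W y)%type) dsum_map i j y w =
  path2 (V := fun y => (V y * W y)%type) dsum_map j i y w.
Proof. by move=> ij; rewrite !dsum_path2 (rmap_rel V) // (rmap_rel W). Qed.

Definition dsum : rep K n d :=
  @Rep K n d (fun y => (V y * W y)%type : vectType K) dsum_map dsum_arrow
    dsum_rel.

End DirectSum.

Definition dsums (K : fieldType) n d (s : seq (rep K n d)) : rep K n d :=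
  foldr (@dsum K n d) (rzero K n d) s.

Section IntervalModule.
Variables (K : fieldType) (n d : nat) (x : os n d.+1).

Definition msupp (y : os n d) : bool :=
  [forall i : 'I_d, (x (widen_ord (leqnSn d) i) <= y i <= x (lift ord0 i))%N].

(* K^1 on the support and K^0 outside of it. *)
Definition msp (y : os n d) : vectType K := 'rV[K]_(msupp y).

(* [pid_mx 1] is the identity of K^1 if y and z are both in the support, and
   is a matrix with no entries otherwise. *)
Definition mfun (y z : os n d) : 'Hom(msp y, msp z) :=
  linfun (mulmxr (pid_mx 1 : 'M[K]_(msupp y, msupp z))).

Definition mmap (y z : os n d) : 'Hom(msp y, msp z) :=
  if arrow y z then mfun y z else 0.

Lemma mmap_arrow y z : ~~ arrow y z -> mmap y z = 0.
Proof. by rewrite /mmap => /negbTE ->. Qed.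

Lemma step_inj (i : 'I_d) (y z z' : os n d) : step i y z -> step i y z' -> z = z'.
Proof.
move=> /forallP s1 /forallP s2; apply: osP => j.
by apply/eqP; rewrite -(eqn_add2r (j == i)) -(eqP (s1 j)) -(eqP (s2 j)).
Qed.

Lemma msupp_between (y z w : os n d) :
  msupp y -> msupp w ->
  (forall i : 'I_d, (w i <= z i <= y i)%N) -> msupp z.
Proof.
move=> /forallP sy /forallP sw zb; apply/forallP => i.
have /andP[wz zy] := zb i; have /andP[xw _] := sw i; have /andP[_ yx] := sy i.
by rewrite (leq_trans xw wz) (leq_trans zy yx).
Qed.

Lemma swap_step (i j : 'I_d) (y z w : os n d) : i != j -> msupp y -> msupp w ->
  step i y z -> step j z w -> exists z', step j y z' && step i z' w.
Proof.
move=> ij sy sw /forallP yz /forallP zw.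
have ey l : (y l : nat) = (w l + (l == j) + (l == i))%N.
  by rewrite (eqP (yz l)) (eqP (zw l)).
pose t := [tuple if l == j then w l else y l | l < d].
have te l : tnth t l = if l == j then w l else y l by rewrite tnth_mktuple.
have tw l : (w l <= tnth t l <= y l)%N.
  have wy : (w l <= y l)%N by rewrite ey -addnA leq_addr.
  by rewrite te; case: eqP => _; rewrite leqnn wy.
have st : sorted (relpre val leq) t.
  apply/sorted_tnthP => a b; rewrite leq_eqVlt => /orP[/eqP/val_inj->//|ab].
  have /andP[_ ta] := tw a; have /andP[tb _] := tw b.
  have /andP[_ yx] := forallP sy a; have /andP[xw _] := forallP sw b.
  apply: leq_trans ta _; apply: leq_trans yx _; apply: leq_trans _ tb.
  apply: leq_trans _ xw.
  by apply: (sorted_tnthP _ (os_sorted x)); rewrite /= /bump.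
have ji : (j == i) = false by rewrite eq_sym; apply/negbTE.
exists (Os st); apply/andP; split; apply/forallP => l;
  rewrite {1}/entry /= ?te ?[Os st l]te; case: (eqVneq l j) => [->|lj].
- by rewrite ey eqxx ji addn0.
- by rewrite addn0.
- by rewrite ji addn0.
- by rewrite ey (negbTE lj) addn0.
Qed.

Lemma mmap_comp (i j : 'I_d) (y z w : os n d) : msupp y -> msupp w ->
  step i y z -> step j z w -> (mmap z w \o mmap y z)%VF = mfun y w.
Proof.
move=> sy sw yz zw; have sz : msupp z.
  apply: msupp_between sy sw _ => l; move/forallP/(_ l)/eqP: yz => ->.
  by move/forallP/(_ l)/eqP: zw => ->; rewrite !leq_addr.
rewrite /mmap (_ : arrow z w); last by apply/existsP; exists j.
rewrite (_ : arrow y z); last by apply/existsP; exists i.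
apply/lfunP => v; rewrite !comp_lfunE !lfunE /= -mulmxA mul_pid_mx.
by rewrite sz sw.
Qed.

Lemma hom_out0 (y w : os n d) (f : 'Hom(msp y, msp w)) :
  ~~ (msupp y && msupp w) -> f = 0.
Proof.
rewrite /msp in f *; move: (msupp y) (msupp w) f => [] [] // f _;
  apply/lfunP => v; rewrite lfunE /=; [exact: thinmx0 | |exact: thinmx0].
by rewrite [v]thinmx0 linear0.
Qed.

Lemma mmap_path2 (i j : 'I_d) (y z w : os n d) : msupp y -> msupp w ->
  step i y z -> step j z w -> path2 mmap i j y w = mfun y w.
Proof.
move=> sy sw yz zw; rewrite /path2 (bigD1 z) ?yz ?zw //= big1 ?addr0.
  exact: mmap_comp yz zw.
by move=> z' /andP[/andP[yz' _]]; rewrite (step_inj yz' yz) eqxx.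
Qed.

Lemma mmap_rel (i j : 'I_d) (y w : os n d) : i != j ->
  path2 mmap i j y w = path2 mmap j i y w.
Proof.
move=> ij; have [/andP[sy sw]|/hom_out0 h0] := boolP (msupp y && msupp w);
  last by rewrite (h0 (path2 _ i j y w)) (h0 (path2 _ j i y w)).
have [/existsP[z /andP[yz zw]]|no] :=
  boolP [exists z, step i y z && step j z w].
  have [z' /andP[yz' zw']] := swap_step ij sy sw yz zw.
  by rewrite (mmap_path2 sy sw yz zw) (mmap_path2 sy sw yz' zw').
rewrite /path2 [LHS]big_pred0 ?[RHS]big_pred0 // => z; apply/negbTE.
  apply: contra no => /andP[yz zw]; apply/existsP.
  by apply: swap_step yz zw => //; rewrite eq_sym.
by apply: contra no => h; apply/existsP; exists z.
Qed.

Definition Mx : rep K n d := Rep mmap_arrow mmap_rel.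

End IntervalModule.

Section Torsion.
Variables (K : fieldType) (n d : nat).
Implicit Types V W M : rep K n d.

(* Full subcategories are given by their objects. *)
Definition inM V : Prop :=
  exists s : seq (os n d.+1), iso V (dsums [seq Mx K x | x <- s]).

Definition add_closed (U : rep K n d -> Prop) : Prop :=
  [/\ forall V W, iso V W -> U V -> U W,
      U (rzero K n d),
      forall V W, U V -> U W -> U (dsum V W) &
      forall V W, U (dsum V W) -> U V].

(* The ambient subcategory, to be taken [d]-cluster tilting. *)
Variable C : rep K n d -> Prop.

(* M = X 0, V_1 = X 1, V_2 = X 2, ... *)
Definition seq_from M (V : nat -> rep K n d) (k : nat) : rep K n d :=
  if k is k'.+1 then V k' else M.

(* 0 -> UM -> M -> V_1 -> ... -> V_d -> X d.+1 = 0 is exact with terms in C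
   and, for all W in U, so is
   0 -> Hom(W, V_1) -> ... -> Hom(W, V_d) -> Hom(W, X d.+1) = 0.
   The X k with k > d.+1 play no role. *)
Definition torsion_seq (U : rep K n d -> Prop) (M UM : rep K n d)
    (V : nat -> rep K n d) (u : hom UM M)
    (f : forall k, hom (seq_from M V k) (seq_from M V k.+1)) : Prop :=
  let X := seq_from M V in
  [/\ C UM /\ U UM,
      forall k, (1 <= k <= d)%N -> C (X k),
      iso (X d.+1) (rzero K n d),
      [/\ mono u, exact_at u (f 0%N) &
          forall k, (k < d)%N -> exact_at (f k) (f k.+1)] &
      forall W, U W ->
        (forall h : hom W (X 1%N),
           heq (hcomp (f 1%N) h) (hzero W (X 2%N)) -> heq h (hzero W (X 1%N))) /\
        (forall k, (1 <= k < d)%N -> forall h : hom W (X k.+1),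
           heq (hcomp (f k.+1) h) (hzero W (X k.+2)) <->
           exists g : hom W (X k), heq (hcomp (f k) g) h)].

Definition dtorsion_class (U : rep K n d -> Prop) : Prop :=
  [/\ forall V, U V -> C V,
      add_closed U &
      forall M, C M -> exists UM (V : nat -> rep K n d) u f,
        @torsion_seq U M UM V u f].

End Torsion.

Definition index_set (K : fieldType) n d (U : rep K n d -> Prop) :
    {set os n d.+1} :=
  [set x | `[< U (Mx K x) >]].

(* A [d]-torsion class U is determined by [index_set U], so the poset of
   [d]-torsion classes is encoded as this set of sets, ordered by inclusion. *)
Definition dtors_sets (K : fieldType) n d : {set {set os n d.+1}} :=
  [set S | `[< exists2 U, dtorsion_class (@inM K n d) U & index_set U = S >]].

(* Main.v *)
(* Hom(M_z, M_w) is K if z_1 <= w_1 <= z_2 <= ... <= z_{d+1} <= w_{d+1} and 0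
   otherwise, so exactness of complexes of M_x's is combinatorics of
   interlacing.  For x and k < x_{d+1} with a = (x_1, ..., x_d, k), there is an
   exact sequence 0 -> M_a -> M_x -> V_1 -> ... -> V_d -> 0 with
   V_d = M_(x_2 + 1, ..., x_d + 1, k + 1, x_{d+1}).

   If S is torclosed, the torsion subobject of M_x is M_a with k maximal such
   that a is in S (or 0, or M_x).  Applying Hom(M_z, -) with z in S to the
   sequence can only lose exactness at V_d, when M_z has a nonzero d-extension
   by M_a; the two conditions on S and the maximality of k exclude this.

   Conversely let U be a d-torsion class.  A nonzero map from M_z in U to M_x
   factors through the torsion subobject of M_x, hence through some M_a in U
   with a as above; if z_{d+1} = x_{d+1} then a = x, which gives the filter
   condition.  If M_a and the V_d above are in U, a diagram chase comparing the
   torsion sequence of M_x with a projective resolution of V_d shows that M_x is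
   in U.  The torclosed condition follows by induction on the number of entries
   of x that differ from k. *)

Require Import Defs.
From HB Require Import structures.
From mathcomp Require Import all_boot all_order all_algebra.
From mathcomp Require Import boolp zify.
(* Otherwise [hom] is the one of vector.v. *)
Import Defs.
Set Implicit Arguments.
Unset Strict Implicit.
Unset Printing Implicit Defensive.
Import GRing.Theory.
Local Open Scope ring_scope.

(** * Morphisms of representations *)

Section HomModule.
Variables (K : fieldType) (n d : nat).
Implicit Types V W X Y : rep K n d.

Lemma hom_ext V W (f g : hom V W) : heq f g -> f = g.
Proof.
case: f g => [f fn] [g gn] /= fg.
have efg : f = g by apply: functional_extensionality_dep => y; exact: fg.
by case: g / efg gn {fg} => gn; congr Hom; apply: Prop_irrelevance.
Qed.

Lemma hom_natE V W (f : hom V W) y z v :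
  f z (rmap V y z v) = rmap W y z (f y v).
Proof. by have /lfunP/(_ v) := hmap_nat f y z; rewrite !comp_lfunE. Qed.

HB.instance Definition _ V W := gen_eqMixin (hom V W).
HB.instance Definition _ V W := gen_choiceMixin (hom V W).

Section Operations.
Variables (V W : rep K n d).

Fact hadd_nat (f g : hom V W) y z :
  ((f z + g z) \o rmap V y z = rmap W y z \o (f y + g y))%VF.
Proof. by rewrite comp_lfunDl comp_lfunDr !hmap_nat. Qed.

Definition hadd (f g : hom V W) := Hom (hadd_nat f g).

Fact hopp_nat (f : hom V W) y z :
  ((- f z) \o rmap V y z = rmap W y z \o (- f y))%VF.
Proof. by rewrite comp_lfunNl comp_lfunNr !hmap_nat. Qed.

Definition hopp (f : hom V W) := Hom (hopp_nat f).

Fact hscale_nat (a : K) (f : hom V W) y z :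
  ((a *: f z) \o rmap V y z = rmap W y z \o (a *: f y))%VF.
Proof. by rewrite -comp_lfunZl -comp_lfunZr hmap_nat. Qed.

Definition hscale (a : K) (f : hom V W) := Hom (hscale_nat a f).

Fact haddA : associative hadd.
Proof. by move=> f g h; apply: hom_ext => y; apply: addrA. Qed.

Fact haddC : commutative hadd.
Proof. by move=> f g; apply: hom_ext => y; apply: addrC. Qed.

Fact hadd0 : left_id (hzero V W) hadd.
Proof. by move=> f; apply: hom_ext => y; apply: add0r. Qed.

Fact haddN : left_inverse (hzero V W) hopp hadd.
Proof. by move=> f; apply: hom_ext => y; apply: addNr. Qed.

HB.instance Definition _ := GRing.isZmodule.Build (hom V W)
  haddA haddC hadd0 haddN.

Fact hscaleA (a b : K) (f : hom V W) : hscale a (hscale b f) = hscale (a * b) f.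
Proof. by apply: hom_ext => y; apply: scalerA. Qed.

Fact hscale1 : left_id 1 hscale.
Proof. by move=> f; apply: hom_ext => y; apply: scale1r. Qed.

Fact hscaleDr : right_distributive hscale +%R.
Proof. by move=> a f g; apply: hom_ext => y; apply: scalerDr. Qed.

Fact hscaleDl (f : hom V W) : {morph hscale^~ f : a b / a + b}.
Proof. by move=> a b; apply: hom_ext => y; apply: scalerDl. Qed.

HB.instance Definition _ := GRing.Zmodule_isLmodule.Build K (hom V W)
  hscaleA hscale1 hscaleDr hscaleDl.

End Operations.

Lemma hmapD V W (f g : hom V W) y : (f + g) y = f y + g y. Proof. by []. Qed.
Lemma hmapN V W (f : hom V W) y : (- f) y = - f y. Proof. by []. Qed.
Lemma hmapZ V W a (f : hom V W) y : (a *: f) y = a *: f y. Proof. by []. Qed.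
Lemma hmap0 V W y : (0 : hom V W) y = 0. Proof. by []. Qed.

End HomModule.

Declare Scope hom_scope.
Delimit Scope hom_scope with H.
Local Notation "g ** f" := (hcomp g f) (at level 40, left associativity) : hom_scope.
Local Open Scope hom_scope.

Section Composition.
Variables (K : fieldType) (n d : nat).
Implicit Types V W X Y : rep K n d.

Lemma hcompE V W X (g : hom W X) (f : hom V W) y v : (g ** f) y v = g y (f y v).
Proof. by rewrite /= comp_lfunE. Qed.

Lemma hcompA V W X Y (h : hom X Y) (g : hom W X) (f : hom V W) :
  h ** (g ** f) = h ** g ** f.
Proof. by apply: hom_ext => y /=; apply: comp_lfunA. Qed.

Lemma hcomp1l V W (f : hom V W) : hid W ** f = f.
Proof. by apply: hom_ext => y /=; apply: comp_lfun1l. Qed.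

Lemma hcomp1r V W (f : hom V W) : f ** hid V = f.
Proof. by apply: hom_ext => y /=; apply: comp_lfun1r. Qed.

Lemma hcomp0l V W X (f : hom V W) : (0 : hom W X) ** f = 0.
Proof. by apply: hom_ext => y /=; apply: comp_lfun0l. Qed.

Lemma hcomp0r V W X (g : hom W X) : g ** (0 : hom V W) = 0.
Proof. by apply: hom_ext => y /=; apply: comp_lfun0r. Qed.

Lemma hcompDl V W X (g g' : hom W X) (f : hom V W) :
  (g + g') ** f = g ** f + g' ** f.
Proof. by apply: hom_ext => y /=; apply: comp_lfunDl. Qed.

Lemma hcompDr V W X (g : hom W X) (f f' : hom V W) :
  g ** (f + f') = g ** f + g ** f'.
Proof. by apply: hom_ext => y /=; apply: comp_lfunDr. Qed.

Lemma hcompNl V W X (g : hom W X) (f : hom V W) : (- g) ** f = - (g ** f).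
Proof. by apply: hom_ext => y /=; apply: comp_lfunNl. Qed.

Lemma hcompNr V W X (g : hom W X) (f : hom V W) : g ** (- f) = - (g ** f).
Proof. by apply: hom_ext => y /=; apply: comp_lfunNr. Qed.

Lemma hcompBl V W X (g g' : hom W X) (f : hom V W) :
  (g - g') ** f = g ** f - g' ** f.
Proof. by rewrite hcompDl hcompNl. Qed.

Lemma hcompBr V W X (g : hom W X) (f f' : hom V W) :
  g ** (f - f') = g ** f - g ** f'.
Proof. by rewrite hcompDr hcompNr. Qed.

Lemma hcompZl V W X a (g : hom W X) (f : hom V W) :
  (a *: g) ** f = a *: (g ** f).
Proof. by apply: hom_ext => y /=; rewrite comp_lfunZl. Qed.

Lemma hcompZr V W X a (g : hom W X) (f : hom V W) :
  g ** (a *: f) = a *: (g ** f).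
Proof. by apply: hom_ext => y /=; rewrite comp_lfunZr. Qed.

Lemma isoP V W : iso V W <->
  exists (f : hom V W) (g : hom W V), g ** f = hid V /\ f ** g = hid W.
Proof.
by split=> -[f [g [gf fg]]]; exists f, g; split;
  rewrite ?gf ?fg //; apply: hom_ext.
Qed.

Lemma iso_refl V : iso V V.
Proof. by apply/isoP; exists (hid V), (hid V); rewrite hcomp1l. Qed.

Lemma iso_sym V W : iso V W -> iso W V.
Proof. by move=> [f [g [gf fg]]]; exists g, f. Qed.

Lemma iso_trans V W X : iso V W -> iso W X -> iso V X.
Proof.
move=> /isoP[f [g [gf fg]]] /isoP[f' [g' [gf' fg']]]; apply/isoP.
exists (f' ** f), (g ** g'); split.
  by rewrite -hcompA (hcompA g') gf' hcomp1l.
by rewrite -hcompA (hcompA f) fg hcomp1l.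
Qed.

Lemma exact_comp0 V W X (f : hom V W) (g : hom W X) :
  exact_at f g -> g ** f = 0.
Proof.
move=> ex; apply: hom_ext => y; apply/lfunP => v; rewrite hcompE lfunE /=.
by apply/eqP; rewrite -memv_ker -ex memv_img ?memvf.
Qed.

(** The pointwise inverses of [u] on its image assemble into a morphism; naturality follows from
    injectivity of [u]. *)
Lemma mono_exact_lift V W X Y (u : hom V W) (f : hom W X) (h : hom Y W) :
  mono u -> exact_at u f -> f ** h = 0 -> exists g : hom Y V, h = u ** g.
Proof.
move=> mu ex fh0.
have hu y v : h y v \in limg (u y).
  rewrite ex memv_ker -hcompE fh0; apply/eqP.
  by rewrite lfunE.
have uK y v : u y ((u y)^-1%VF (h y v)) = h y v := limg_lfunVK (hu y v).
have uI y : injective (u y).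
  by apply/lker0P/eqP; apply: mu.
have gn y z : (((u z)^-1 \o h z) \o rmap Y y z =
  rmap V y z \o ((u y)^-1 \o h y))%VF.
  apply/lfunP => v; rewrite !comp_lfunE; apply: (uI z).
  by rewrite uK hom_natE hom_natE uK.
by exists (Hom gn); apply: hom_ext => y; apply/lfunP => v; rewrite /= !comp_lfunE uK.
Qed.

End Composition.

(** * Biproducts of representations *)

Section Biproduct.
Variables (K : fieldType) (n d : nat).
Implicit Types V W X Y : rep K n d.

Section Maps.
Variables (V W : rep K n d).

Definition inl_fun y (v : V y) : V y * W y := (v, 0).
Definition inr_fun y (w : W y) : V y * W y := (0, w).

Fact inl_fun_linear y : linear (@inl_fun y).
Proof.
by move=> a u v; apply/pair_equal_spec; split; rewrite //= scaler0 addr0.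
Qed.
HB.instance Definition _ y := GRing.isLinear.Build K _ _ _ _ (@inl_fun_linear y).

Fact inr_fun_linear y : linear (@inr_fun y).
Proof.
by move=> a u v; apply/pair_equal_spec; split; rewrite //= scaler0 addr0.
Qed.
HB.instance Definition _ y := GRing.isLinear.Build K _ _ _ _ (@inr_fun_linear y).

Fact hinl_nat y z :
  (linfun (@inl_fun z) \o rmap V y z = rmap (dsum V W) y z \o linfun (@inl_fun y))%VF.
Proof.
by apply/lfunP => v; rewrite !comp_lfunE lpairE !lfunE /inl_fun /= linear0.
Qed.
Definition hinl : hom V (dsum V W) := Hom (W := dsum V W) hinl_nat.

Fact hinr_nat y z :
  (linfun (@inr_fun z) \o rmap W y z = rmap (dsum V W) y z \o linfun (@inr_fun y))%VF.
Proof.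
by apply/lfunP => v; rewrite !comp_lfunE lpairE !lfunE /inr_fun /= linear0.
Qed.
Definition hinr : hom W (dsum V W) := Hom (W := dsum V W) hinr_nat.

Fact hfst_nat y z :
  (linfun fst \o rmap (dsum V W) y z = rmap V y z \o linfun fst)%VF.
Proof. by apply/lfunP => v; rewrite !comp_lfunE lpairE !lfunE. Qed.
Definition hfst : hom (dsum V W) V := Hom (V := dsum V W) hfst_nat.

Fact hsnd_nat y z :
  (linfun snd \o rmap (dsum V W) y z = rmap W y z \o linfun snd)%VF.
Proof. by apply/lfunP => v; rewrite !comp_lfunE lpairE !lfunE. Qed.
Definition hsnd : hom (dsum V W) W := Hom (V := dsum V W) hsnd_nat.

Lemma hinlE y v : hinl y v = (v, 0). Proof. by rewrite lfunE. Qed.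
Lemma hinrE y w : hinr y w = (0, w). Proof. by rewrite lfunE. Qed.
Lemma hfstE y v : hfst y v = v.1. Proof. by rewrite lfunE. Qed.
Lemma hsndE y v : hsnd y v = v.2. Proof. by rewrite lfunE. Qed.

Lemma hfst_inl : hfst ** hinl = hid V.
Proof.
by apply: hom_ext => y; apply/lfunP => v; rewrite hcompE hinlE hfstE lfunE.
Qed.

Lemma hfst_inr : hfst ** hinr = 0.
Proof.
by apply: hom_ext => y; apply/lfunP => v; rewrite hcompE hinrE hfstE lfunE.
Qed.

Lemma hsnd_inr : hsnd ** hinr = hid W.
Proof.
by apply: hom_ext => y; apply/lfunP => v; rewrite hcompE hinrE hsndE lfunE.
Qed.

Lemma hsnd_inl : hsnd ** hinl = 0.
Proof.
by apply: hom_ext => y; apply/lfunP => v; rewrite hcompE hinlE hsndE lfunE.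
Qed.

Lemma hid_dsum : hinl ** hfst + hinr ** hsnd = hid (dsum V W).
Proof.
apply: hom_ext => y; apply/lfunP => v.
rewrite hmapD add_lfunE !hcompE hinlE hinrE hfstE hsndE lfunE /=.
by rewrite [RHS]surjective_pairing; congr pair; rewrite /= ?addr0 ?add0r.
Qed.

End Maps.

Lemma hom_to_dsumE V W X (h : hom X (dsum V W)) :
  h = hinl V W ** (hfst V W ** h) + hinr V W ** (hsnd V W ** h).
Proof. by rewrite !hcompA -hcompDl hid_dsum hcomp1l. Qed.

Lemma hom_from_dsumE V W X (h : hom (dsum V W) X) :
  h = h ** hinl V W ** hfst V W + h ** hinr V W ** hsnd V W.
Proof. by rewrite -!hcompA -hcompDr hid_dsum hcomp1r. Qed.

Definition hdsum V W V' W' (f : hom V V') (g : hom W W') :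
    hom (dsum V W) (dsum V' W') :=
  hinl V' W' ** f ** hfst V W + hinr V' W' ** g ** hsnd V W.

Lemma hdsumE V W V' W' (f : hom V V') (g : hom W W') y v :
  hdsum f g y v = (f y v.1, g y v.2).
Proof.
rewrite /hdsum hmapD add_lfunE !hcompE hfstE hsndE hinlE hinrE.
by congr pair; rewrite /= ?addr0 ?add0r.
Qed.

Lemma hfst_dsum V W V' W' (f : hom V V') (g : hom W W') :
  hfst V' W' ** hdsum f g = f ** hfst V W.
Proof.
by rewrite hcompDr !hcompA hfst_inl hfst_inr hcomp1l !hcomp0l addr0.
Qed.

Lemma hsnd_dsum V W V' W' (f : hom V V') (g : hom W W') :
  hsnd V' W' ** hdsum f g = g ** hsnd V W.
Proof.
by rewrite hcompDr !hcompA hsnd_inl hsnd_inr hcomp1l !hcomp0l add0r.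
Qed.

Lemma hdsum_inl V W V' W' (f : hom V V') (g : hom W W') :
  hdsum f g ** hinl V W = hinl V' W' ** f.
Proof.
by rewrite hcompDl -!hcompA hfst_inl hsnd_inl hcomp1r !hcomp0r addr0.
Qed.

Lemma hdsum_inr V W V' W' (f : hom V V') (g : hom W W') :
  hdsum f g ** hinr V W = hinr V' W' ** g.
Proof.
by rewrite hcompDl -!hcompA hfst_inr hsnd_inr hcomp1r !hcomp0r add0r.
Qed.

Lemma hdsum_comp V W V' W' V'' W'' (f : hom V V') (g : hom W W')
    (f' : hom V' V'') (g' : hom W' W'') :
  hdsum f' g' ** hdsum f g = hdsum (f' ** f) (g' ** g).
Proof.
by rewrite {2}/hdsum hcompDr !hcompA hdsum_inl hdsum_inr /hdsum !hcompA.
Qed.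

Lemma hdsum_id V W : hdsum (hid V) (hid W) = hid (dsum V W).
Proof. by rewrite /hdsum !hcomp1r hid_dsum. Qed.

Lemma iso_dsum V W V' W' : iso V V' -> iso W W' -> iso (dsum V W) (dsum V' W').
Proof.
move=> /isoP[f [g [gf fg]]] /isoP[f' [g' [gf' fg']]]; apply/isoP.
by exists (hdsum f f'), (hdsum g g'); rewrite !hdsum_comp gf fg gf' fg' !hdsum_id.
Qed.

Lemma iso_biproduct V W X (i : hom V X) (j : hom W X) (p : hom X V)
    (q : hom X W) : p ** i = hid V -> q ** j = hid W -> p ** j = 0 ->
  q ** i = 0 -> i ** p + j ** q = hid X -> iso X (dsum V W).
Proof.
move=> pi qj pj qi e; apply/isoP.
exists (hinl V W ** p + hinr V W ** q), (i ** hfst V W + j ** hsnd V W); split.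
  rewrite hcompDl -!hcompA (hcompDr (hfst _ _)) (hcompDr (hsnd _ _)).
  rewrite !(hcompA (hfst _ _)) !(hcompA (hsnd _ _)).
  by rewrite hfst_inl hfst_inr hsnd_inl hsnd_inr !hcomp0l !hcomp1l add0r addr0.
rewrite hcompDl -!hcompA (hcompDr p) (hcompDr q) !(hcompA p) !(hcompA q).
by rewrite pi pj qi qj !hcomp0l !hcomp1l add0r addr0 hid_dsum.
Qed.

Lemma iso_dsumC V W : iso (dsum V W) (dsum W V).
Proof.
apply: (iso_biproduct (i := hinr V W) (j := hinl V W) (p := hsnd V W)
  (q := hfst V W)); rewrite ?hsnd_inr ?hfst_inl ?hfst_inr ?hsnd_inl //.
by rewrite addrC hid_dsum.
Qed.

Lemma hom_rzero_l V (f : hom (rzero K n d) V) : f = 0.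
Proof.
apply: hom_ext => y; apply/lfunP => v.
by rewrite [v]thinmx0 !linear0.
Qed.

Lemma hom_rzero_r V (f : hom V (rzero K n d)) : f = 0.
Proof.
by apply: hom_ext => y; apply/lfunP => v; rewrite hmap0 [RHS]lfunE; apply: thinmx0.
Qed.

Lemma iso_dsum0 V : iso V (dsum (rzero K n d) V).
Proof.
apply: (iso_biproduct (i := 0) (j := hid V) (p := 0) (q := hid V)).
- by rewrite hcomp0l [RHS]hom_rzero_l.
- by rewrite hcomp1l.
- by rewrite hcomp0l.
- by rewrite hcomp0r.
- by rewrite hcomp0l hcomp1l add0r.
Qed.

Lemma iso_dsumA V W X : iso (dsum (dsum V W) X) (dsum V (dsum W X)).
Proof.
apply: (iso_biproduct (i := hinl _ X ** hinl V W)
  (j := hdsum (hinr V W) (hid X))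
  (p := hfst V W ** hfst _ X) (q := hdsum (hsnd V W) (hid X))).
- by rewrite -!hcompA (hcompA (hfst _ X)) hfst_inl hcomp1l hfst_inl.
- by rewrite hdsum_comp hcomp1l hsnd_inr hdsum_id.
- by rewrite -hcompA hfst_dsum hcompA hfst_inr hcomp0l.
- by rewrite hcompA hdsum_inl -hcompA hsnd_inl hcomp0r.
rewrite hdsum_comp hcomp1l /hdsum hcomp1r addrA.
by rewrite !hcompA -hcompDl -!hcompA -hcompDr hid_dsum hcomp1r hid_dsum.
Qed.

Lemma iso_dsums_cat (s t : seq (rep K n d)) :
  iso (dsum (dsums s) (dsums t)) (dsums (s ++ t)).
Proof.
elim: s => [|V s ih] /=; first exact: iso_sym (iso_dsum0 _).
apply: iso_trans (iso_dsumA _ _ _) _.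
by apply: iso_dsum => //; apply: iso_refl.
Qed.

End Biproduct.

(** * Interlacing sequences and morphisms between interval modules *)

Section Entries.
Variables (n d : nat).
Implicit Types (x y : os n d).

(* Indices start at 0; the value is 0 from index d on. *)
Definition ent x (i : nat) : nat := nth 0%N (map val (os_tuple x)) i.

Lemma entryE x (i : 'I_d) : x i = ent x i :> nat.
Proof.
pose x0 := tnth (os_tuple x) i.
by rewrite /entry /ent (tnth_nth x0) (nth_map x0) ?size_tuple.
Qed.

Lemma ent_inj x y : (forall i, (i < d)%N -> ent x i = ent y i) -> x = y.
Proof. by move=> e; apply: osP => i; rewrite !entryE e. Qed.

Lemma ent_mono x i j : (i <= j)%N -> (j < d)%N -> (ent x i <= ent x j)%N.
Proof.
move=> ij jd; have id := leq_ltn_trans ij jd.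
rewrite -(entryE x (Ordinal id)) -(entryE x (Ordinal jd)).
exact: (sorted_tnthP _ (os_sorted x)).
Qed.

Lemma ent_lt x i : (i < d)%N -> (ent x i < n)%N.
Proof. by move=> id; rewrite -(entryE x (Ordinal id)). Qed.

(* The sequence with entries [f i], if there is one; [u] only witnesses that
   n > 0. *)
Definition os_of (u : 'I_n) (f : nat -> nat) : os n d :=
  insubd (diag_fun d u) [tuple insubd u (f i) | i < d].

Lemma ent_os_of u (f : nat -> nat) :
  (forall i, (i < d)%N -> (f i < n)%N) ->
  (forall i j, (i <= j)%N -> (j < d)%N -> (f i <= f j)%N) ->
  forall i, (i < d)%N -> ent (os_of u f) i = f i.
Proof.
move=> fn fm i id; rewrite -(entryE _ (Ordinal id)) /entry /os_of.
have te (j : 'I_d) : tnth [tuple insubd u (f i) | i < d] j = f j :> nat.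
  by rewrite tnth_mktuple insubdK //; apply: fn.
have st : sorted (relpre val leq) [tuple insubd u (f i) | i < d].
  by apply/sorted_tnthP => a b ab; rewrite !te fm.
by rewrite -[os_tuple _]/(val _) insubdK ?te.
Qed.

(** A rank function on the vertices: every arrow lowers it by one and it is bounded, so it drives
    inductions along paths in both directions. *)
Definition entry_sum x : nat := \sum_(i < d) ent x i.

Lemma entry_sum_le x : (entry_sum x <= d * n)%N.
Proof.
rewrite -[X in (_ <= X * _)%N]card_ord -sum_nat_const.
by apply: leq_sum => i _; apply/ltnW/ent_lt.
Qed.

Lemma stepP (i : 'I_d) x y :
  reflect (forall j, (j < d)%N -> ent x j = ent y j + (j == i))%N (step i x y).
Proof.
apply: (iffP forallP) => h j; last by rewrite !entryE; apply/eqP/h.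
by move=> jd; have /eqP := h (Ordinal jd); rewrite !entryE.
Qed.

Lemma entry_sum_step i x y : step i x y -> entry_sum x = (entry_sum y).+1.
Proof.
move=> /stepP s; rewrite /entry_sum (eq_bigr (fun j : 'I_d => ent y j + (j == i)))%N.
  rewrite big_split /= -addn1; congr (_ + _)%N; rewrite (bigD1 i) //= eqxx.
  by rewrite big1 // => j; rewrite -val_eqE => /negPf ->.
by move=> j _; rewrite s.
Qed.

Lemma arrow_ge x y i : arrow x y -> (i < d)%N -> (ent y i <= ent x i)%N.
Proof. by move=> /existsP[j /stepP s] id; rewrite s // leq_addr. Qed.

End Entries.

Section Vertices.
Variables (n d : nat).
Implicit Types (x z w v : os n d.+1) (y : os n d).

Lemma msuppP x y :
  reflect (forall i, (i < d)%N -> (ent x i <= ent y i <= ent x i.+1)%N) (msupp x y).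
Proof.
apply: (iffP forallP) => h i.
  by move=> id; have := h (Ordinal id); rewrite !entryE /= /bump add1n.
by have := h i (ltn_ord i); rewrite !entryE /= /bump add1n.
Qed.

(** Arrows lower entries, so these are the extreme vertices of the support of M_x: [top x] generates
    it and [soc x] carries its socle. *)
Definition top x : os n d := os_of d (x ord0) (fun i => ent x i.+1).
Definition soc x : os n d := os_of d (x ord0) (ent x).

Lemma ent_top x i : (i < d)%N -> ent (top x) i = ent x i.+1.
Proof.
by move=> id; rewrite ent_os_of // => [j jd|j k jk kd]; [apply: ent_lt|apply: ent_mono].
Qed.

Lemma ent_soc x i : (i < d)%N -> ent (soc x) i = ent x i.
Proof.
move=> id; rewrite ent_os_of // => [j jd|j k jk kd]; first by apply: ent_lt; lia.
by apply: ent_mono => //; lia.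
Qed.

Lemma msupp_top x : msupp x (top x).
Proof. by apply/msuppP => i id; rewrite ent_top // leqnn ent_mono. Qed.

Lemma msupp_soc x : msupp x (soc x).
Proof. by apply/msuppP => i id; rewrite ent_soc // leqnn ent_mono. Qed.

(** Raising entry i of y keeps it sorted because x separates the entries of y: y_i + 1 <= x_{i+1} <=
    y_{i+1}, with indices from 0. *)
Lemma msupp_up x y (i : 'I_d) : msupp x y -> (ent y i < ent x i.+1)%N ->
  exists2 y', msupp x y' & step i y' y.
Proof.
move=> /msuppP s yi; pose f j := (ent y j + (j == i))%N.
have fx j : (j < d)%N -> (ent x j <= f j <= ent x j.+1)%N.
  by move=> jd; have := s j jd; rewrite /f; case: eqP => [->|]; lia.
have ef j : (j < d)%N -> ent (os_of d (x ord0) f) j = f j.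
  apply: ent_os_of => [k kd|k l kl ld].
    by have /andP[_ h] := fx k kd; apply: leq_ltn_trans h (ent_lt _ _).
  have [->//|kl'] := eqVneq k l; have kd : (k < d)%N by lia.
  have /andP[_ h] := fx k kd; have /andP[h' _] := fx l ld.
  by apply: leq_trans h (leq_trans (ent_mono _ _ _) h'); lia.
exists (os_of d (x ord0) f); first by apply/msuppP => j jd; rewrite ef // fx.
by apply/stepP => j jd; rewrite ef.
Qed.

Lemma msupp_down x y (i : 'I_d) : msupp x y -> (ent x i < ent y i)%N ->
  exists2 y', msupp x y' & step i y y'.
Proof.
move=> /msuppP s yi; pose f j := (ent y j - (j == i))%N.
have fx j : (j < d)%N -> (ent x j <= f j <= ent x j.+1)%N.
  by move=> jd; have := s j jd; rewrite /f; case: eqP => [->|]; lia.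
have ef j : (j < d)%N -> ent (os_of d (x ord0) f) j = f j.
  apply: ent_os_of => [k kd|k l kl ld].
    by have /andP[_ h] := fx k kd; apply: leq_ltn_trans h (ent_lt _ _).
  have [->//|kl'] := eqVneq k l; have kd : (k < d)%N by lia.
  have /andP[_ h] := fx k kd; have /andP[h' _] := fx l ld.
  by apply: leq_trans h (leq_trans (ent_mono _ _ _) h'); lia.
exists (os_of d (x ord0) f); first by apply/msuppP => j jd; rewrite ef // fx.
apply/stepP => j jd; rewrite ef // /f; case: eqP => [->|_]; last by lia.
by rewrite subn1 addn1 prednK //; lia.
Qed.

(* The condition for Hom(M_z, M_w) to be nonzero. *)
Definition interlace z w : bool :=
  [forall i : 'I_d.+1, ent z i <= ent w i]%N &&
  [forall i : 'I_d, ent w i <= ent z i.+1]%N.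

Lemma interlaceP z w :
  reflect ((forall i, i <= d -> ent z i <= ent w i)%N /\
           (forall i, i < d -> ent w i <= ent z i.+1)%N) (interlace z w).
Proof.
apply: (iffP andP) => [[/forallP h1 /forallP h2]|[h1 h2]].
  by split=> i id; [apply: (h1 (Ordinal (id : i < d.+1)%N))|apply: (h2 (Ordinal id))].
by split; apply/forallP => i; [apply: h1; case: i|apply: h2].
Qed.

Lemma interlace_refl z : interlace z z.
Proof. by apply/interlaceP; split=> i id //; apply: ent_mono. Qed.

(** Reduces the vanishing of Hom(M_z, M_w) to two vertices: a morphism is determined by its value at
    [top z], and also by its value at [soc w]. *)
Lemma interlace_top_soc z w : (0 < d)%N ->
  interlace z w = msupp w (top z) && msupp z (soc w).
Proof.
move=> d0; apply/interlaceP/andP => [[h1 h2]|[/msuppP s /msuppP t]]; split.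
- by apply/msuppP => i id; rewrite ent_top // h1 ?h2.
- by apply/msuppP => i id; rewrite ent_soc // h2 ?h1 //; lia.
- move=> i; rewrite leq_eqVlt => /orP[/eqP ->|id].
    have dd : (d.-1 < d)%N by lia.
    by have := s _ dd; rewrite ent_top // prednK // => /andP[].
  by have := t _ id; rewrite ent_soc // => /andP[].
- by move=> i id; have := s _ id; rewrite ent_top // => /andP[].
Qed.

(** For the naturality of [cmap]: when the start and end corners of a square are nonzero, so are
    both intermediate ones. *)
Lemma interlace_supp z w y y' : interlace z w -> msupp z y -> msupp w y' ->
  (forall i, (i < d)%N -> (ent y' i <= ent y i)%N) -> msupp w y && msupp z y'.
Proof.
move=> /interlaceP[h1 h2] /msuppP zy /msuppP wy' le.
apply/andP; split; apply/msuppP => i id;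
  have := zy i id; have := wy' i id; have := le i id; have := h1 i (ltnW id);
  have := h1 i.+1 id; have := h2 i id; lia.
Qed.

End Vertices.

Section BoolMaps.
Variable K : fieldType.
Implicit Types a b c : bool.

(** The canonical map between spaces of dimension 0 or 1; it has the form of the structure maps of
    [Mx], so structure maps and morphisms compose by one rule. *)
Definition bool_map a b : 'Hom('rV[K]_a, 'rV[K]_b) :=
  linfun (mulmxr (pid_mx 1 : 'M[K]_(a, b))).

Lemma bool_mapE a b (u : 'rV[K]_a) : bool_map a b u = u *m pid_mx 1.
Proof. by rewrite lfunE. Qed.

Lemma bool_map0 a b : ~~ (a && b) -> bool_map a b = 0.
Proof.
case: a b => [] [] // _; apply/lfunP => u; rewrite lfunE [RHS]lfunE /=;
  by [apply: thinmx0 | rewrite thinmx0 mul0mx].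
Qed.

Lemma bool_map_comp a b c :
  (bool_map b c \o bool_map a b)%VF = if b then bool_map a c else 0.
Proof.
case: b; last first.
  by rewrite bool_map0 ?comp_lfun0l.
apply/lfunP => u; rewrite comp_lfunE !bool_mapE -mulmxA mul_pid_mx.
by case: a c u => [] [].
Qed.

Lemma bool_map_surj a b (v : 'rV[K]_b) : a -> exists u, v = bool_map a b u.
Proof.
case: a b v => [] // [] v _; first by exists v; rewrite bool_mapE pid_mx_1 mulmx1.
by exists 0; apply: etrans (thinmx0 _) (esym (thinmx0 _)).
Qed.

Lemma bool_map_inj a b (u : 'rV[K]_a) : b -> bool_map a b u = 0 -> u = 0.
Proof.
case: a b u => [] [] // u _; last by rewrite thinmx0.
by rewrite bool_mapE pid_mx_1 mulmx1.
Qed.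

Lemma row_bool a (u : 'rV[K]_a) : exists k, u = k *: const_mx 1.
Proof.
case: a u => u; last by exists 0; apply: etrans (thinmx0 _) (esym (thinmx0 _)).
exists (u 0 0); apply/matrixP => i j; rewrite !mxE mulr1 !ord1.
by congr (u _ _); apply: val_inj; case: j => -[].
Qed.

Lemma bool_map_const a b : a -> b -> bool_map a b (const_mx 1) = const_mx 1.
Proof.
case: a b => [] [] // _ _; rewrite bool_mapE.
by rewrite (pid_mx_1 K true) mulmx1.
Qed.

Lemma const_mx1_neq0 a : a -> const_mx 1 != 0 :> 'rV[K]_a.
Proof.
case: a => // _; apply/eqP => /matrixP/(_ 0 0)/eqP.
by rewrite !mxE oner_eq0.
Qed.

Lemma hom_bool a b (f : 'Hom('rV[K]_a, 'rV[K]_b)) : exists k, f = k *: bool_map a b.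
Proof.
have [k fk] := row_bool (f (const_mx 1)); exists k; apply/lfunP => u.
have [c ->] := row_bool u; rewrite !linearZ; congr (_ *: _).
rewrite /= scale_lfunE fk; have [/andP[at_ bt]|ab0] := boolP (a && b).
  by rewrite bool_map_const.
have v0 (v : 'rV[K]_b) : ~~ b -> v = 0 by case: b {f fk ab0} v => // v _; apply: thinmx0.
move: ab0; rewrite negb_and => /orP[a0|b0]; last by rewrite (v0 (_ *: _)) // [RHS]v0.
have c0 : const_mx 1 = 0 :> 'rV[K]_a by case: a {f fk u} a0 => // _; apply: thinmx0.
by rewrite -fk c0 !linear0.
Qed.

Lemma bool_map_neq0 a b : a -> b -> bool_map a b <> 0.
Proof.
move=> at_ bt /lfunP/(_ (const_mx 1)); rewrite bool_map_const // lfunE /= => /eqP.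
by apply/negP/const_mx1_neq0.
Qed.

End BoolMaps.

Section IntervalHoms.
Variables (K : fieldType) (n d : nat).
Implicit Types (x z w v : os n d.+1) (y : os n d) (X : rep K n d).
Local Notation M := (@Mx K n d).

Lemma Mx_map z y y' : arrow y y' ->
  rmap (M z) y y' = bool_map K (msupp z y) (msupp z y').
Proof. by rewrite /= /mmap => ->. Qed.

Lemma hom_off_supp z X (h : hom (M z) X) y : ~~ msupp z y -> h y = 0.
Proof.
move=> zy; apply/lfunP => u; rewrite lfunE /=; move: (h y) u; rewrite /= /msp.
by rewrite (negPf zy) => f u; rewrite [u]thinmx0 linear0.
Qed.

Lemma hom_to_off_supp z X (h : hom X (M z)) y : ~~ msupp z y -> h y = 0.
Proof.
move=> zy; apply/lfunP => u; rewrite [RHS]lfunE /=; move: (h y); rewrite /= /msp.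
by rewrite (negPf zy) => f; apply: thinmx0.
Qed.

(** M_z is generated at [top z]: any other vertex of the support is reached from one of larger rank
    by a surjective structure map, which carries the vanishing downwards. *)
Lemma hom_top0 z X (h : hom (M z) X) : h (top z) = 0 -> h = 0.
Proof.
move=> h0; apply: hom_ext => y.
have [m] := ubnP (d * n - entry_sum y); elim: m y => // m ih y ym.
have [zy|] := boolP (msupp z y); last exact: hom_off_supp.
have [/existsP[i yi]|/existsPn max] := boolP [exists i : 'I_d, ent y i < ent z i.+1]%N.
  have [y' zy' sy'] := msupp_up zy yi.
  have y'0 : h y' = 0.
    by apply: ih; have := entry_sum_le y'; rewrite (entry_sum_step sy') in ym *; lia.
  have ar : arrow y' y by apply/existsP; exists i.
  apply/lfunP => u; have [u' eu] := bool_map_surj u zy'.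
  have -> : u = rmap (M z) y' y u' by rewrite Mx_map.
  by rewrite hom_natE y'0 !lfunE /= linear0.
suff -> : y = top z by [].
apply: ent_inj => i id; rewrite ent_top //; have := max (Ordinal id).
by have /msuppP/(_ i id) := zy; rewrite /=; lia.
Qed.

(** Dual to generation at the top: structure maps inside the support are injective, so vanishing at
    the socle propagates upwards. *)
Lemma hom_soc0 z X (h : hom X (M z)) : h (soc z) = 0 -> h = 0.
Proof.
move=> h0; apply: hom_ext => y.
have [m] := ubnP (entry_sum y); elim: m y => // m ih y ym.
have [zy|] := boolP (msupp z y); last exact: hom_to_off_supp.
have [/existsP[i yi]|/existsPn min] := boolP [exists i : 'I_d, ent z i < ent y i]%N.
  have [y' zy' sy'] := msupp_down zy yi.
  have y'0 : h y' = 0 by apply: ih; rewrite (entry_sum_step sy') in ym; lia.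
  have ar : arrow y y' by apply/existsP; exists i.
  apply/lfunP => u; rewrite [RHS]lfunE /=; apply: (bool_map_inj zy').
  have := @hom_natE _ _ _ _ _ h y y' u; rewrite Mx_map // => <-.
  by rewrite y'0 lfunE.
suff -> : y = soc z by [].
apply: ent_inj => i id; rewrite ent_soc //; have := min (Ordinal id).
by have /msuppP/(_ i id) := zy; rewrite /=; lia.
Qed.

Fact cmap_nat z w y y' : interlace z w ->
  (bool_map K (msupp z y') (msupp w y') \o rmap (M z) y y' =
   rmap (M w) y y' \o bool_map K (msupp z y) (msupp w y))%VF.
Proof.
move=> zw; have [ar|nar] := boolP (arrow y y'); last first.
  by rewrite !rmap_arrow // comp_lfun0l comp_lfun0r.
rewrite !Mx_map // !bool_map_comp.
have [|no] := boolP (msupp z y && msupp w y').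
  case/andP=> zy wy'; have := interlace_supp zw zy wy'.
  by case/(_ (fun i => arrow_ge ar))/andP=> -> ->.
by rewrite bool_map0 // !if_same.
Qed.

(** The canonical generator of Hom(M_z, M_w). Matching on [boolP] supplies the interlacing proof on
    which naturality rests. *)
Definition cmap z w : hom (M z) (M w) :=
  if boolP (interlace z w) is AltTrue zw then
    @Hom K n d (M z) (M w) (fun y => bool_map K (msupp z y) (msupp w y))
      (fun y y' => cmap_nat y y' zw)
  else 0.

Lemma cmapE z w y : interlace z w -> cmap z w y = bool_map K (msupp z y) (msupp w y).
Proof. by rewrite /cmap; case: {-}_ / boolP => // /negPf ->. Qed.

Hypothesis d_gt0 : (0 < d)%N.

Lemma hom_interlace0 z w (h : hom (M z) (M w)) : ~~ interlace z w -> h = 0.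
Proof.
rewrite interlace_top_soc // negb_and => /orP[s|s].
  by apply: hom_top0; apply: hom_to_off_supp.
by apply: hom_soc0; apply: hom_off_supp.
Qed.

(** A morphism is determined at [top z], where both spaces have dimension at most 1. *)
Lemma hom_cmap z w (h : hom (M z) (M w)) : exists a, h = a *: cmap z w.
Proof.
have [zw|nzw] := boolP (interlace z w); last first.
  by exists 0; rewrite scale0r; apply: hom_interlace0.
have [a ha] := hom_bool (h (top z)); exists a.
apply/eqP; rewrite -subr_eq0; apply/eqP; apply: hom_top0.
by rewrite hmapD hmapN hmapZ cmapE // ha subrr.
Qed.

Lemma cmap_neq0 z w : interlace z w -> cmap z w <> 0.
Proof.
move=> zw /(congr1 (fun h : hom _ _ => h (top z))); rewrite cmapE //.
move: zw; rewrite interlace_top_soc // => /andP[wz _].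
by apply: bool_map_neq0; rewrite ?msupp_top.
Qed.

(** A vertex in the supports of M_z and M_v also lies in that of M_w, so nothing is lost in the
    middle. *)
Lemma cmap_comp z w v : interlace z w -> interlace w v -> interlace z v ->
  cmap w v ** cmap z w = cmap z v.
Proof.
move=> zw wv zv; apply: hom_ext => y /=; rewrite !cmapE // bool_map_comp.
have [/andP[zy vy]|no] := boolP (msupp z y && msupp v y).
  suff -> : msupp w y by [].
  apply/msuppP => i id; move/msuppP/(_ i id): zy; move/msuppP/(_ i id): vy.
  have /interlaceP[/(_ i.+1 id) h1 _] := zw.
  have /interlaceP[/(_ i (ltnW id)) h2 _] := wv.
  lia.
by rewrite bool_map0 // if_same.
Qed.

Lemma cmap_id z : cmap z z = hid (M z).
Proof.
apply: hom_ext => y; rewrite cmapE ?interlace_refl //=; apply/lfunP => u.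
rewrite bool_mapE lfunE /=; move: u; rewrite /= /msp; case: (msupp z y) => u.
  by rewrite pid_mx_1 mulmx1.
by apply: etrans (thinmx0 _) (esym (thinmx0 _)).
Qed.

End IntervalHoms.

(** * Direct sums of interval modules and their summands *)

Section Kernel.
Variables (K : fieldType) (n d : nat) (V W : rep K n d) (f : hom V W).

Definition ker_sp (y : os n d) : vectType K := subvs_of (lker (f y)).

Definition ker_map (y z : os n d) : 'Hom(ker_sp y, ker_sp z) :=
  linfun (vsproj (lker (f z)) \o rmap V y z \o vsval).

Lemma ker_mapE y z v : vsval (ker_map y z v) = rmap V y z (vsval v).
Proof.
rewrite lfunE /= vsprojK // memv_ker hom_natE.
by have := subvsP v; rewrite memv_ker => /eqP ->; rewrite linear0.
Qed.

Fact ker_arrow y z : ~~ arrow y z -> ker_map y z = 0.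
Proof.
move=> nyz; apply/lfunP => v; apply: val_inj.
by rewrite /= ker_mapE rmap_arrow // !lfunE.
Qed.

Lemma ker_path2 i j y w v :
  vsval (path2 ker_map i j y w v) = path2 (rmap V) i j y w (vsval v).
Proof.
rewrite /path2 !sum_lfunE raddf_sum; apply: eq_bigr => z _.
by rewrite !comp_lfunE /= !ker_mapE.
Qed.

Fact ker_rel (i j : 'I_d) y w : i != j ->
  path2 ker_map i j y w = path2 ker_map j i y w.
Proof.
by move=> ij; apply/lfunP => v; apply: val_inj; rewrite /= !ker_path2 rmap_rel.
Qed.

Definition rker : rep K n d := Rep ker_arrow ker_rel.

Fact rker_nat y z :
  (linfun (@vsval _ _ (lker (f z))) \o rmap rker y z =
   rmap V y z \o linfun (@vsval _ _ (lker (f y))))%VF.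
Proof.
apply/lfunP => v; rewrite !comp_lfunE [LHS]lfunE [X in rmap V y z X]lfunE.
exact: ker_mapE.
Qed.

Definition hker : hom rker V := Hom (V := rker) rker_nat.

Lemma mono_hker : mono hker.
Proof.
move=> y; apply/eqP/lker0P => u v; rewrite /= !lfunE /=; apply: subvs_inj.
Qed.

Lemma exact_hker : exact_at hker f.
Proof.
move=> y; apply/vspaceP => v; apply/memv_imgP/idP => [[u _ ->]|kv].
  by rewrite lfunE /=; apply: subvsP.
by exists (vsproj (lker (f y)) v); rewrite ?memvf // lfunE /= vsprojK.
Qed.

End Kernel.

Lemma mono_inj (K : fieldType) n d (V W X : rep K n d) (u : hom V W) (f g : hom X V) :
  mono u -> u ** f = u ** g -> f = g.
Proof.
move=> mu ufg; apply: hom_ext => y; apply/lfunP => v.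
have /lker0P : lker (u y) == 0%VS by apply/eqP/mu.
by apply; rewrite -!hcompE ufg.
Qed.

Section Sums.
Variables (K : fieldType) (n d : nat).
Implicit Types (x z w : os n d.+1) (S : {set os n d.+1}) (V W X : rep K n d).
Local Notation M := (@Mx K n d).

(** The additive closure of the M_x with x in S: the subcategory that a set of indices stands
    for. *)
Definition sums S V : Prop :=
  exists2 s : seq (os n d.+1), {subset s <= S} & iso V (dsums [seq M x | x <- s]).

Lemma inM_sums V : inM V <-> sums setT V.
Proof. by split=> [[s Vs]|[s _ Vs]]; exists s => // x _; rewrite inE. Qed.

Lemma sumsS S S' V : {subset S <= S'} -> sums S V -> sums S' V.
Proof. by move=> SS' [s sS Vs]; exists s => // x /sS/SS'. Qed.

Lemma sums_iso S V W : iso V W -> sums S V -> sums S W.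
Proof. by move=> VW [s sS Vs]; exists s => //; apply: iso_trans (iso_sym VW) Vs. Qed.

Lemma sums0 S : sums S (rzero K n d).
Proof. by exists [::] => //; apply: iso_refl. Qed.

Lemma sums_dsum S V W : sums S V -> sums S W -> sums S (dsum V W).
Proof.
move=> [s sS Vs] [t tS Wt]; exists (s ++ t).
  by move=> x; rewrite mem_cat => /orP[/sS|/tS].
by rewrite map_cat; apply: iso_trans (iso_dsums_cat _ _); apply: iso_dsum.
Qed.

Lemma iso_dsum_0r V : iso V (dsum V (rzero K n d)).
Proof. exact: iso_trans (iso_dsum0 V) (iso_dsumC _ _). Qed.

Lemma sums_Mx S x : x \in S -> sums S (M x).
Proof.
by move=> xS; exists [:: x]; [move=> z /[!inE]/eqP -> | apply: iso_dsum_0r].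
Qed.

Lemma sums_ind S (P : rep K n d -> Prop) :
  (forall V W, iso V W -> P V -> P W) -> P (rzero K n d) ->
  (forall x, x \in S -> P (M x)) -> (forall V W, P V -> P W -> P (dsum V W)) ->
  forall V, sums S V -> P V.
Proof.
move=> Piso P0 PM PD V [s sS /iso_sym Vs]; apply: Piso Vs _.
elim: s sS => //= x s ih sS; apply: PD; last first.
  by apply: ih => z zs; rewrite sS // inE zs orbT.
by apply: PM; rewrite sS // mem_head.
Qed.

Hypothesis d_gt0 : (0 < d)%N.

(* Either M_x -> V -> M_x is nonzero and M_x splits off V, or N = (V -> M_x -> V)
   has square 0 and 1 - N, the composite through the other summands, is
   invertible. *)
Lemma sums_retract S V (s : seq (os n d.+1)) (i : hom V (dsums (map M s)))
    (p : hom (dsums (map M s)) V) :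
  {subset s <= S} -> p ** i = hid V -> sums S V.
Proof.
elim: s V i p => [|x s ih] /= V i p sS pi.
  apply: sums_iso (sums0 S); apply/isoP; exists p, i; split=> //.
  by rewrite [LHS]hom_rzero_l [RHS]hom_rzero_l.
have xS : x \in S by rewrite sS // mem_head.
have {}sS : {subset s <= S} by move=> z zs; rewrite sS // inE zs orbT.
set D := dsums _ in i p pi ih *.
pose px := hfst (M x) D ** i; pose i' := hsnd (M x) D ** i.
pose jx := p ** hinl (M x) D; pose p' := p ** hinr (M x) D.
have pi' : p' ** i' = hid V - jx ** px.
  apply/eqP; rewrite eq_sym subr_eq -pi {1}[i]hom_to_dsumE addrC.
  by rewrite hcompDr !hcompA.
have [c pj] := hom_cmap d_gt0 (px ** jx); rewrite cmap_id in pj.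
have [c0|c0] := eqVneq c 0.
  (* N has square 0 here, so 1 + N inverts 1 - N and V is a retract of the other summands. *)
  apply: (ih _ i' ((hid V + jx ** px) ** p')) => //.
  rewrite -hcompA pi' hcompBr hcomp1r hcompDl hcomp1l hcompA -(hcompA jx) pj c0.
  by rewrite scale0r hcomp0r hcomp0l addr0 addrK.
(* The idempotent complementary to the split copy of M_x; its image is the kernel of [px], so V is
   M_x plus that kernel. *)
pose e := hid V - c^-1 *: (jx ** px).
have pe : px ** e = 0.
  rewrite hcompBr hcomp1r hcompZr hcompA pj hcompZl hcomp1l scalerA.
  by rewrite mulVf // scale1r subrr.
have ej : e ** jx = 0.
  rewrite hcompBl hcomp1l hcompZl -hcompA pj hcompZr hcomp1r scalerA.
  by rewrite mulVf // scale1r subrr.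
have pk : px ** hker px = 0 := exact_comp0 (exact_hker px).
have [r er] := mono_exact_lift (mono_hker px) (exact_hker px) pe.
have rk : r ** hker px = hid (rker px).
  apply: (mono_inj (mono_hker px)); rewrite hcompA -er hcompBl hcomp1l hcomp1r.
  by rewrite hcompZl -hcompA pk hcomp0r scaler0 subr0.
have rj : r ** jx = 0.
  by apply: (mono_inj (mono_hker px)); rewrite hcompA -er ej hcomp0r.
apply: (@sums_iso _ (dsum (M x) (rker px))).
  apply: iso_sym; apply: (iso_biproduct (i := c^-1 *: jx) (p := px)
    (j := hker px) (q := r)) => //.
  - by rewrite hcompZr pj scalerA mulVf // scale1r.
  - by rewrite hcompZr rj scaler0.
  - by rewrite -er hcompZl /e addrC subrK.
apply: sums_dsum; first exact: sums_Mx.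
(* The kernel is a retract of the remaining summands: [p' ** i'] is [hid V - jx ** px], and [px]
   vanishes on the kernel. *)
apply: (ih _ (i' ** hker px) (r ** p')) => //.
rewrite hcompA -(hcompA r) pi' hcompBr hcomp1r hcompBl rk hcompA rj.
by rewrite !hcomp0l subr0.
Qed.

Lemma sums_summand S V W : sums S (dsum V W) -> sums S V.
Proof.
move=> [s sS /isoP[f [g [gf _]]]].
apply: (@sums_retract _ _ s (f ** hinl V W) (hfst V W ** g)) => //.
by rewrite hcompA -(hcompA _ g) gf hcomp1r hfst_inl.
Qed.

End Sums.

(** * Projective interval modules and exactness tested on them *)

Section Projectives.
Variables (K : fieldType) (n d : nat).
Hypothesis d_gt0 : (0 < d)%N.
Implicit Types (x z w : os n d.+1) (y : os n d) (V W X : rep K n d).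
Local Notation M := (@Mx K n d).
Local Notation inM := (@inM K n d).

Definition gen z : M z (top z) := const_mx 1.

Lemma hom_gen0 z X (h : hom (M z) X) : h (top z) (gen z) = 0 -> h = 0.
Proof.
move=> h0; apply: hom_top0; apply/lfunP => u; rewrite lfunE /=.
have [k ->] := row_bool u; rewrite -[_ *: _]/(k *: gen z) linearZ /= h0 scaler0 //.
Qed.

(* Representations [M z] with first entry 0 are projective. *)
Lemma hom_proj X z (v : X (top z)) : inM X -> ent z 0 = 0%N ->
  exists h : hom (M z) X, h (top z) (gen z) = v.
Proof.
move=> XM z0; move: v; move/inM_sums: XM; move: X; apply: sums_ind.
- move=> V W /isoP[f [g [gf fg]]] VP v; have [h hv] := VP (g _ v).
  exists (f ** h); rewrite hcompE hv -hcompE fg /=; apply/eqP.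
  by rewrite lfunE.
- by move=> v; exists 0; rewrite [v]thinmx0 lfunE.
- move=> w _ v; have [wz|wz] := boolP (msupp w (top z)); last first.
    exists 0; rewrite lfunE /=; move: v; rewrite /= /msp (negPf wz) => v.
    by rewrite [v]thinmx0.
  have zw : interlace z w.
    apply/interlaceP; split=> i id.
      case: i id => [|i] id; first by rewrite z0.
      by have /msuppP/(_ i id) := wz; rewrite ent_top // => /andP[].
    by have /msuppP/(_ i id) := wz; rewrite ent_top // => /andP[].
  have [k vk] := row_bool v; exists (k *: cmap K z w).
  rewrite hmapZ scale_lfunE cmapE //= vk; congr (_ *: _).
  exact: bool_map_const (msupp_top z) wz.
move=> V W VP WP v; have [h hv] := VP v.1; have [h' hv'] := WP v.2.
exists (hinl V W ** h + hinr V W ** h'); rewrite hmapD add_lfunE !hcompE hv hv'.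
rewrite hinlE hinrE [RHS]surjective_pairing.
by congr pair; rewrite /= ?addr0 ?add0r.
Qed.

Lemma proj_lift V W X z (f : hom V W) (g : hom W X) (h : hom (M z) W) :
  inM V -> ent z 0 = 0%N -> exact_at f g -> g ** h = 0 ->
  exists h' : hom (M z) V, h = f ** h'.
Proof.
move=> VM z0 ex gh.
have : h (top z) (gen z) \in limg (f (top z)).
  by rewrite ex memv_ker -hcompE gh lfunE.
case/memv_imgP => v _ hv; have [h' hv'] := hom_proj v VM z0; exists h'.
apply/eqP; rewrite -subr_eq0; apply/eqP; apply: hom_gen0.
by rewrite hmapD hmapN add_lfunE opp_lfunE hcompE hv' hv subrr.
Qed.

(** The index (0, y_1, ..., y_d), whose module corepresents evaluation at the vertex y on sums of
    interval modules. *)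
Definition proj_at y : os n d.+1 :=
  os_of d.+1 (y (Ordinal d_gt0)) (fun i => if i is j.+1 then ent y j else 0%N).

Lemma ent_proj_at y i : (i <= d)%N ->
  ent (proj_at y) i = if i is j.+1 then ent y j else 0%N.
Proof.
move=> id; rewrite ent_os_of // => [[|j] jd|[|j] [|k] jk kd] //.
- by apply: leq_ltn_trans (ltn_ord (y (Ordinal d_gt0))).
- exact: ent_lt.
- exact: ent_mono.
Qed.

Lemma top_proj_at y : top (proj_at y) = y.
Proof. by apply: ent_inj => i id; rewrite ent_top // ent_proj_at. Qed.

(** Evaluation at y is Hom from the projective at y, so exactness at each vertex is visible on
    morphisms out of projectives. *)
Lemma exact_from_proj V W X (f : hom V W) (g : hom W X) : inM W -> g ** f = 0 ->
  (forall z (h : hom (M z) W), ent z 0 = 0%N -> g ** h = 0 -> exists h', h = f ** h') ->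
  exact_at f g.
Proof.
move=> WM gf ex y; rewrite -(top_proj_at y).
have: ent (proj_at y) 0 = 0%N by rewrite ent_proj_at.
move: (proj_at y) => z z0; apply/vspaceP => v; apply/idP/idP.
  by case/memv_imgP => u _ ->; rewrite memv_ker -hcompE gf lfunE.
rewrite memv_ker => /eqP gv; have [h hv] := hom_proj v WM z0.
have [|h' hh'] := ex z h z0.
  by apply: hom_gen0; rewrite hcompE hv.
by rewrite -hv hh' hcompE memv_img ?memvf.
Qed.

Lemma mono_from_proj V W (f : hom V W) : inM V ->
  (forall z (h : hom (M z) V), ent z 0 = 0%N -> f ** h = 0 -> h = 0) -> mono f.
Proof.
move=> VM mf y; rewrite -(top_proj_at y).
have: ent (proj_at y) 0 = 0%N by rewrite ent_proj_at.
move: (proj_at y) => z z0; apply/eqP; rewrite -subv0; apply/subvP => v.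
rewrite memv_ker => /eqP gv; have [h hv] := hom_proj v VM z0.
rewrite memv0 -hv (mf z h z0) ?lfunE //.
by apply: hom_gen0; rewrite hcompE hv.
Qed.

End Projectives.

(** * Resolutions by interval modules *)

Section Resolution.
Variables (n d : nat) (a : os n d.+1) (j : nat).
Implicit Types (z w : os n d.+1).

(* The terms of 0 -> M_a -> M_(a_1, ..., a_d, j) -> V_1 -> ... -> V_d -> 0, where
   V_k is M_(a_1, ..., a_{d-k}, a_{d-k+2} + 1, ..., a_{d+1} + 1, j).  If a_1 = 0,
   all terms but V_d are projective. *)
Definition res_ent (k i : nat) : nat :=
  if k is k'.+1 then
    if (i + k' < d)%N then ent a i else if (i < d)%N then (ent a i.+1).+1 else j
  else ent a i.

Definition res k : os n d.+1 := os_of d.+1 (a ord0) (res_ent k).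

Hypotheses (d_gt0 : (0 < d)%N) (aj : (ent a d < j)%N) (jn : (j < n)%N).

Let am i l : (i <= l <= d)%N -> (ent a i <= ent a l)%N.
Proof. by case/andP=> il ld; apply: ent_mono. Qed.

Lemma ent_res k i : (i <= d)%N -> ent (res k) i = res_ent k i.
Proof.
move=> id; apply: ent_os_of => // [i' id'|i' l il ld]; case: k => [|k] /=.
- exact: ent_lt.
- have := ent_lt a (i := i') id'; have := am (i := i'.+1) (l := d).
  by repeat case: ifP; lia.
- exact: ent_mono.
have := am (i := i') (l := l); have := am (i := i') (l := l.+1).
have := am (i := i'.+1) (l := l.+1); have := am (i := i') (l := d).
have := am (i := i'.+1) (l := d).
by repeat case: ifP; lia.
Qed.

Lemma res0 : res 0 = a.
Proof. by apply: ent_inj => i id; rewrite ent_res. Qed.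

Lemma res1 i : (i <= d)%N ->
  ent (res 1) i = if (i < d)%N then ent a i else j.
Proof. by move=> id; rewrite ent_res //= addn0; case: (i < d)%N. Qed.

Lemma interlace_resS k : interlace (res k) (res k.+1).
Proof.
apply/interlaceP; split=> i id; rewrite !ent_res //; try lia.
  have := am (i := i) (l := i.+1).
  have [->|ne] := eqVneq i d; case: k => [|k] /=; rewrite ?addn0;
  by repeat case: ifP; lia.
have := am (i := i) (l := i.+1); have := am (i := i.+1) (l := i.+2).
have [e|ne] := eqVneq i.+1 d; rewrite ?e; case: k => [|k] /=; rewrite ?addn0 ?e ?ltnn;
by repeat case: ifP; lia.
Qed.

(** Exactness of Hom(M_z, -) at term k+1. With p = d-k-1, term k changes only entry p+1 of term k+1
    and term k+2 only entry p; they ask for complementary inequalities between [ent z p.+1] and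
    [ent a p.+1]. *)
Lemma interlace_res_or z k : (k < d)%N -> interlace z (res k.+1) ->
  interlace z (res k) || interlace z (res k.+2).
Proof.
move=> kd /interlaceP[h1 h2].
have [p dE] : exists p, d = (p + k.+1)%N by exists (d - k.+1)%N; lia.
have [c|c] := leqP (ent z p.+1) (ent a p.+1); apply/orP; [left|right];
  apply/interlaceP; split=> i id.
- have := h1 i id; rewrite !ent_res //; have [->|ne] := eqVneq i p.+1.
    by case: k {kd h1 h2} dE => [|k] /= dE; repeat case: ifP; lia.
  by case: k {kd h1 h2} dE => [|k] /= dE; repeat case: ifP; lia.
- have := h2 i id; rewrite !ent_res; try lia; have := am (i := i) (l := i.+1).
  have [e|ne] := eqVneq i p.+1; last first.
    by case: k {kd h1 h2} dE => [|k] /= dE; repeat case: ifP; lia.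
  by rewrite e; case: k {kd h1 h2} dE => [|k] /= dE; repeat case: ifP; lia.
- have := h1 i id; rewrite !ent_res //; have := am (i := i) (l := i.+1).
  by move=> /=; repeat case: ifP; lia.
have := h2 i id; rewrite !ent_res; try lia; have := am (i := i) (l := i.+1).
have [->|ne] := eqVneq i p => /=; repeat case: ifP; lia.
Qed.

(** The same comparison at entry p+1 makes the two alternatives exclusive; hence consecutive maps
    compose to 0. *)
Lemma interlace_res_gap z k : (k < d)%N -> interlace z (res k) ->
  ~~ interlace z (res k.+2).
Proof.
move=> kd /interlaceP[h1 _]; apply/negP => /interlaceP[_ h2].
have [p dE] : exists p, d = (p + k.+1)%N by exists (d - k.+1)%N; lia.
have := h1 p.+1; have := h2 p; rewrite !ent_res; try lia.
by case: k {kd h1 h2} dE => [|k] /= dE; repeat case: ifP; lia.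
Qed.

(** The last two terms differ in entry 0 only, so the bound on [ent z 0] is the one condition
    missing; it is automatic when M_z is projective. *)
Lemma interlace_res_last z : interlace z (res d.+1) -> (ent z 0 <= ent a 0)%N ->
  interlace z (res d).
Proof.
move=> zr c; move: zr; suff: forall k, k = d -> interlace z (res k.+1) ->
  interlace z (res k) by apply.
move=> [|k] kE /interlaceP[h1 h2]; first by lia.
apply/interlaceP; split=> i id.
- have := h1 i id; rewrite !ent_res //; have [->|ne] := eqVneq i 0%N;
  by move=> /=; repeat case: ifP; lia.
- have := h2 i id; rewrite !ent_res; try lia; have := am (i := i) (l := i.+1).
  by move=> /=; repeat case: ifP; lia.
Qed.

(** The contravariant counterpart, for Hom(-, M_w): the decisive comparison is between [ent w p] and
    [ent a p.+1]. *)
Lemma res_interlace_or w k : (k < d)%N -> interlace (res k.+1) w ->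
  interlace (res k) w || interlace (res k.+2) w.
Proof.
move=> kd /interlaceP[h1 h2].
have [p dE] : exists p, d = (p + k.+1)%N by exists (d - k.+1)%N; lia.
have [c|c] := leqP (ent w p) (ent a p.+1); apply/orP; [left|right];
  apply/interlaceP; split=> i id.
- have := h1 i id; rewrite !ent_res //; have := am (i := i) (l := i.+1).
  have [->|ne] := eqVneq i d.
    by case: k {kd h1 h2} dE => [|k] /= dE; repeat case: ifP; lia.
  by case: k {kd h1 h2} dE => [|k] /= dE; repeat case: ifP; lia.
- have := h2 i id; rewrite !ent_res; try lia; have [->|ne] := eqVneq i p.
    by case: k {kd h1 h2} dE => [|k] /= dE; repeat case: ifP; lia.
  by case: k {kd h1 h2} dE => [|k] /= dE; repeat case: ifP; lia.
- have := h1 i id; rewrite !ent_res //; have [->|ne] := eqVneq i p;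
  by move=> /=; repeat case: ifP; lia.
have := h2 i id; rewrite !ent_res; try lia; have := am (i := i.+1) (l := i.+2).
by move=> /=; repeat case: ifP; lia.
Qed.

End Resolution.

(** * Torsion sequences from closed sets *)

Section Factor.
Variables (K : fieldType) (n d : nat) (S : {set os n d.+1}).
Implicit Types V W X : rep K n d.
Local Notation M := (@Mx K n d).

(** The identity of X is the sum of the idempotents of its summands, so a nonzero composite through
    X stays nonzero through one of them. *)
Lemma sums_factor X : sums S X -> forall A B (g : hom A X) (h : hom X B),
  h ** g <> 0 -> exists2 z, z \in S & exists (i : hom (M z) X) (p : hom X (M z)),
    p ** i = hid (M z) /\ h ** i ** (p ** g) <> 0.
Proof.
move: X; apply: sums_ind.
- move=> V W /isoP[f [f' [f'f ff']]] VP A B g h hg.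
  have [|z zS [i [p [pi hpg]]]] := VP _ _ (f' ** g) (h ** f).
    by rewrite hcompA -(hcompA h) ff' hcomp1r.
  exists z => //; exists (f ** i), (p ** f'); split.
    by rewrite hcompA -(hcompA p) f'f hcomp1r.
  by move: hpg; rewrite !hcompA.
- by move=> A B g h []; rewrite (hom_rzero_l h) hcomp0l.
- move=> x xS A B g h hg; exists x => //; exists (hid _), (hid _).
  by rewrite !hcomp1l hcomp1r.
move=> V W VP WP A B g h; rewrite [g]hom_to_dsumE hcompDr => hg.
have [e|/eqP hV] := eqVneq (h ** (hinl V W ** (hfst V W ** g))) 0; last first.
  have [|z zS [i [p [pi hpg]]]] := VP _ _ (hfst V W ** g) (h ** hinl V W).
    by rewrite -hcompA.
  exists z => //; exists (hinl V W ** i), (p ** hfst V W); split.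
    by rewrite hcompA -(hcompA p) hfst_inl hcomp1r.
  by rewrite -hom_to_dsumE; move: hpg; rewrite !hcompA.
have hW : h ** (hinr V W ** (hsnd V W ** g)) <> 0 by move=> e'; rewrite e e' addr0 in hg.
have [|z zS [i [p [pi hpg]]]] := WP _ _ (hsnd V W ** g) (h ** hinr V W).
  by rewrite -hcompA.
exists z => //; exists (hinr V W ** i), (p ** hsnd V W); split.
  by rewrite hcompA -(hcompA p) hsnd_inr hcomp1r.
by rewrite -hom_to_dsumE; move: hpg; rewrite !hcompA.
Qed.

Hypothesis d_gt0 : (0 < d)%N.

Lemma hom_neq0_interlace z w (h : hom (M z) (M w)) : h <> 0 -> interlace z w.
Proof. by move=> h0; apply: contra_notT h0 => zw; apply: hom_interlace0. Qed.

Lemma comp_neq0 V W X (g : hom W X) (f : hom V W) : g ** f <> 0 -> g <> 0 /\ f <> 0.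
Proof. by move=> gf; split=> e; apply: gf; rewrite e ?hcomp0l ?hcomp0r. Qed.

Lemma Mx_id_neq0 x : hid (M x) <> 0.
Proof. by rewrite -cmap_id; apply: cmap_neq0 => //; apply: interlace_refl. Qed.

Lemma interlace_anti (z w : os n d.+1) : interlace z w -> interlace w z -> z = w.
Proof.
move=> /interlaceP[h1 _] /interlaceP[h2 _]; apply: ent_inj => i id.
by apply/eqP; rewrite eqn_leq h1 // h2.
Qed.

(** [sums_factor] at the identity of M_x gives nonzero morphisms both ways between M_x and some M_z
    with z in S, and interlacing is antisymmetric. *)
Lemma sums_Mx_in x : sums S (M x) -> x \in S.
Proof.
move=> Sx; have [|z zS [i [p [_ ip]]]] := @sums_factor _ Sx _ _ (hid _) (hid _).
  by rewrite hcomp1l; apply: Mx_id_neq0.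
have [iz zp] := comp_neq0 ip; have [_ i0] := comp_neq0 iz; have [p0 _] := comp_neq0 zp.
by rewrite (interlace_anti (hom_neq0_interlace p0) (hom_neq0_interlace i0)).
Qed.

End Factor.

Section OptionalModules.
Variables (K : fieldType) (n d : nat).
Hypothesis d_gt0 : (0 < d)%N.
Implicit Types (o : option (os n d.+1)) (z w : os n d.+1).
Local Notation M := (@Mx K n d).

(** [None] stands for the zero object, so complexes of any length become sequences of options
    indexed by [nat]. *)
Definition optM o : rep K n d := if o is Some w then M w else rzero K n d.

Definition optmap o o' : hom (optM o) (optM o') :=
  if o is Some z then if o' is Some w then cmap K z w else 0 else 0.

Definition interlace_opt z o : bool := if o is Some w then interlace z w else false.
Definition opt_interlace o o' : bool :=
  if o is Some z then interlace_opt z o' else false.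

Lemma inM_optM o : inM (optM o).
Proof.
apply/inM_sums; case: o => [w|]; last exact: sums0.
by apply: sums_Mx; rewrite inE.
Qed.

Lemma hom_interlace_opt0 z o (h : hom (M z) (optM o)) : ~~ interlace_opt z o -> h = 0.
Proof. by case: o h => [w|] h; [apply: hom_interlace0|rewrite [h]hom_rzero_r]. Qed.

Lemma hom_optmap z o (h : hom (M z) (optM o)) : exists a, h = a *: optmap (Some z) o.
Proof.
case: o h => [w|] h; first exact: hom_cmap.
by exists 0; rewrite scale0r [h]hom_rzero_r.
Qed.

Lemma optmap_neq0 z o : interlace_opt z o -> optmap (Some z) o <> 0.
Proof. by case: o => [w|] //=; apply: cmap_neq0. Qed.

Lemma optmap_comp z o o' :
  interlace_opt z o -> opt_interlace o o' -> interlace_opt z o' ->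
  optmap o o' ** optmap (Some z) o = optmap (Some z) o'.
Proof. by case: o o' => [w|] [w'|] //=; apply: cmap_comp. Qed.

Lemma optmap_comp0 o o' o'' : ~~ opt_interlace o o'' ->
  optmap o' o'' ** optmap o o' = 0.
Proof.
case: o => [z|] //= no; last exact: hom_rzero_l.
exact: hom_interlace_opt0.
Qed.

(** A morphism from M_z is a scalar times the canonical one. Either the canonical one survives the
    next map, which forces the scalar to be 0, or it lifts to [o]. *)
Lemma optmap_lift z o o' o'' (h : hom (M z) (optM o')) :
  (interlace_opt z o -> interlace_opt z o' -> opt_interlace o o') ->
  (interlace_opt z o' -> interlace_opt z o'' -> opt_interlace o' o'') ->
  (interlace_opt z o' -> interlace_opt z o || interlace_opt z o'') ->
  optmap o' o'' ** h = 0 ->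
  exists g : hom (M z) (optM o), h = optmap o o' ** g.
Proof.
move=> oo' o'o'' ex h0; have [zo'|zo'] := boolP (interlace_opt z o'); last first.
  by exists 0; rewrite hcomp0r; apply: hom_interlace_opt0.
have [c hc] := hom_optmap h; have [zo''|zo''] := boolP (interlace_opt z o'').
  exists 0; rewrite hcomp0r hc; move: h0; rewrite hc hcompZr optmap_comp ?o'o'' //.
  move/eqP; rewrite scaler_eq0 => /orP[/eqP ->|/eqP]; first by rewrite scale0r.
  by move/(optmap_neq0 zo'').
have zo : interlace_opt z o by have := ex zo'; rewrite (negPf zo'') orbF.
by exists (c *: optmap (Some z) o); rewrite hcompZr optmap_comp ?oo'.
Qed.

Lemma optmap_inj z o' o'' (h : hom (M z) (optM o')) :
  (interlace_opt z o' -> interlace_opt z o'' && opt_interlace o' o'') ->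
  optmap o' o'' ** h = 0 -> h = 0.
Proof.
move=> ex h0; have [||||g ->] := @optmap_lift z None o' o'' h; rewrite ?hcomp0l //.
  by move=> /ex/andP[].
by move=> /ex/andP[->]; rewrite orbT.
Qed.

End OptionalModules.

(** * Torsion sequences assembled from complexes of interval modules *)

Section TorsionSequences.
Variables (K : fieldType) (n d : nat).
Hypothesis d_gt0 : (0 < d)%N.
Variable S : {set os n d.+1}.
Implicit Types (V W : rep K n d).
Local Notation M := (@Mx K n d).

Definition hom_exact (X : nat -> rep K n d) (f : forall k, hom (X k) (X k.+1))
    W : Prop :=
  (forall h : hom W (X 1%N), f 1%N ** h = 0 -> h = 0) /\
  forall k, (1 <= k < d)%N -> forall h : hom W (X k.+1), f k.+1 ** h = 0 ->
    exists g : hom W (X k), h = f k ** g.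

(* As torsion_seq, for U = add {M_x | x in S}, but with the exactness after
   applying Hom(W, -) only required for W = M_z. *)
Definition tors_complex (T : rep K n d) (X : nat -> rep K n d) (u : hom T (X 0%N))
    (f : forall k, hom (X k) (X k.+1)) : Prop :=
  [/\ sums S T /\ forall k, inM (X k), iso (X d.+1) (rzero K n d),
      mono u /\ exact_at u (f 0%N),
      forall k, (k < d)%N -> exact_at (f k) (f k.+1) &
      forall z, z \in S -> hom_exact f (M z)].

Lemma hom_exact_sums X f W : (forall z, z \in S -> hom_exact f (M z)) ->
  sums S W -> @hom_exact X f W.
Proof.
move=> ex; move: W; apply: sums_ind => //.
- move=> V W /isoP[p [q [qp pq]]] [ex1 ex2]; split=> [h fh|k kd h fh].
    have {}fh : f 1%N ** (h ** p) = 0 by rewrite hcompA fh hcomp0l.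
    by rewrite -[h]hcomp1r -pq hcompA (ex1 _ fh) hcomp0l.
  have {}fh : f k.+1 ** (h ** p) = 0 by rewrite hcompA fh hcomp0l.
  have [g hg] := ex2 k kd _ fh; exists (g ** q).
  by rewrite hcompA -hg -hcompA pq hcomp1r.
- split=> [h _|k _ h _]; first exact: hom_rzero_l.
  by exists 0; rewrite hcomp0r [h]hom_rzero_l.
move=> V W [V1 V2] [W1 W2]; split=> [h fh|k kd h fh].
  have hl : h ** hinl V W = 0 by apply: V1; rewrite hcompA fh hcomp0l.
  have hr : h ** hinr V W = 0 by apply: W1; rewrite hcompA fh hcomp0l.
  by rewrite [LHS]hom_from_dsumE hl hr !hcomp0l addr0.
have [|g hg] := V2 k kd (h ** hinl V W); first by rewrite hcompA fh hcomp0l.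
have [|g' hg'] := W2 k kd (h ** hinr V W); first by rewrite hcompA fh hcomp0l.
exists (g ** hfst V W + g' ** hsnd V W).
by rewrite hcompDr !hcompA -hg -hg' -hom_from_dsumE.
Qed.

(** Exactness on the M_z extends to their direct sums, and the isomorphism from [X 0] to N is
    absorbed into the two maps next to N. *)
Lemma tors_complex_torsion_seq T X u f N :
  @tors_complex T X u f -> iso (X 0%N) N ->
  exists UM Y u' f', @torsion_seq K n d (@inM K n d) (sums S) N UM Y u' f'.
Proof.
move=> [[ST MX] X0 [mu exu] exf hex] /isoP[p [q [qp pq]]].
pose Y k := X k.+1.
pose f' k : hom (seq_from N Y k) (seq_from N Y k.+1) :=
  match k with 0%N => f 0%N ** q | k'.+1 => f k'.+1 end.
have pI y : injective (p y).
  by move=> a b /(congr1 (q y)); rewrite -!hcompE qp /= !lfunE.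
have limgp y : limg (p y) = fullv.
  apply/vspaceP => v; rewrite memvf; have <- : p y (q y v) = v.
    by rewrite -hcompE pq /= lfunE.
  by rewrite memv_img ?memvf.
exists T, Y, (p ** u), f'; split.
- by split=> //; apply/inM_sums/sumsS/ST => x; rewrite inE.
- by case=> // k _; apply: MX.
- exact: X0.
- split.
  + move=> y; apply/eqP/lker0P => a b; rewrite !hcompE => /pI.
    by apply/lker0P/eqP/mu.
  + move=> y; apply/vspaceP => v; rewrite memv_ker -[f' 0%N]/(f 0%N ** q) hcompE.
    apply/memv_imgP/idP => [[w _ ->]|].
      rewrite hcompE -(hcompE q p) qp /= lfunE -(hcompE (f 0%N) u).
      by rewrite (exact_comp0 exu) lfunE.
    rewrite -memv_ker -exu => /memv_imgP[w _ qv]; exists w; first exact: memvf.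
    by rewrite hcompE -qv -hcompE pq /= lfunE.
  + case=> [|k] kd; last exact: exf.
    move=> y; rewrite /= limg_comp -(exf 0%N) //; congr (_ @: _)%VS.
    apply/vspaceP => v; rewrite memvf; have <- : q y (p y v) = v.
      by rewrite -hcompE qp /= lfunE.
    by rewrite memv_img ?memvf.
move=> W SW; have [e1 e2] := hom_exact_sums hex SW; split.
  by move=> h fh y; rewrite (e1 h (hom_ext fh)).
case=> // k /[dup] kd /andP[_ kd'] h; split=> [fh|[g gh] y].
  have [g hg] := e2 k.+1 kd h (hom_ext fh); exists g => y.
  by rewrite hg.
by rewrite -(hom_ext gh) hcompA (exact_comp0 (exf _ kd')) hcomp0l.
Qed.

Lemma mono_hdsum V W V' W' (f : hom V W) (g : hom V' W') :
  mono f -> mono g -> mono (hdsum f g).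
Proof.
move=> mf mg y; apply/eqP/lker0P => a b; rewrite !hdsumE => -[ea eb].
have /lker0P fI : lker (f y) == 0%VS by apply/eqP/mf.
have /lker0P gI : lker (g y) == 0%VS by apply/eqP/mg.
by rewrite [a]surjective_pairing [b]surjective_pairing (fI _ _ ea) (gI _ _ eb).
Qed.

Lemma exact_hdsum V W X V' W' X' (f : hom V W) (g : hom W X) (f' : hom V' W')
    (g' : hom W' X') :
  exact_at f g -> exact_at f' g' -> exact_at (hdsum f f') (hdsum g g').
Proof.
move=> ex ex' y; apply/vspaceP => v; rewrite memv_ker hdsumE.
have -> : ((g y v.1, g' y v.2) == 0) = (v.1 \in limg (f y)) && (v.2 \in limg (f' y)).
  by rewrite ex ex' !memv_ker.
apply/memv_imgP/andP => [[w _ ->]|[/memv_imgP[a _ e] /memv_imgP[b _ e']]].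
  by rewrite hdsumE /= !memv_img ?memvf.
exists (a, b); first exact: memvf.
by rewrite hdsumE /= -e -e' -surjective_pairing.
Qed.

Lemma tors_complex_dsum T X u f T' X' u' f' :
  @tors_complex T X u f -> @tors_complex T' X' u' f' ->
  @tors_complex (dsum T T') (fun k => dsum (X k) (X' k)) (hdsum u u')
    (fun k => hdsum (f k) (f' k)).
Proof.
move=> [[ST MX] X0 [mu exu] exf hex] [[ST' MX'] X0' [mu' exu'] exf' hex']; split.
- split; first exact: sums_dsum.
  by move=> k; apply/inM_sums; apply: sums_dsum; apply/inM_sums.
- apply: iso_trans (iso_dsum X0 X0') _; exact: iso_sym (iso_dsum0 _).
- by split; [apply: mono_hdsum|apply: exact_hdsum].
- by move=> k kd; apply: exact_hdsum; [apply: exf|apply: exf'].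
move=> z zS; have [e1 e2] := hex z zS; have [e1' e2'] := hex' z zS.
split=> [h fh|k kd h fh].
  have hl : hfst _ _ ** h = 0.
    by apply: e1; rewrite hcompA -(hfst_dsum _ (f' 1%N)) -hcompA fh hcomp0r.
  have hr : hsnd _ _ ** h = 0.
    by apply: e1'; rewrite hcompA -(hsnd_dsum (f 1%N)) -hcompA fh hcomp0r.
  by rewrite [LHS]hom_to_dsumE hl hr !hcomp0r addr0.
have [|g hg] := e2 k kd (hfst _ _ ** h).
  by rewrite hcompA -(hfst_dsum _ (f' k.+1)) -hcompA fh hcomp0r.
have [|g' hg'] := e2' k kd (hsnd _ _ ** h).
  by rewrite hcompA -(hsnd_dsum (f k.+1)) -hcompA fh hcomp0r.
exists (hinl _ _ ** g + hinr _ _ ** g').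
by rewrite hcompDr !hcompA hdsum_inl hdsum_inr -!hcompA -hg -hg' -hom_to_dsumE.
Qed.

(* [o 0] is the torsion subobject, [o k.+1] the k-th term of the complex. *)
Lemma tors_complex_opt (o : nat -> option (os n d.+1)) :
  (forall x, o 0%N = Some x -> x \in S) -> o d.+2 = None ->
  (forall k, ~~ opt_interlace (o k) (o k.+2)) ->
  (forall z k, interlace_opt z (o k) -> interlace_opt z (o k.+1) ->
    opt_interlace (o k) (o k.+1)) ->
  (forall z, ent z 0 = 0%N -> interlace_opt z (o 0%N) -> interlace_opt z (o 1%N)) ->
  (forall z k, ent z 0 = 0%N -> (k <= d)%N -> interlace_opt z (o k.+1) ->
    interlace_opt z (o k) || interlace_opt z (o k.+2)) ->
  (forall z, z \in S -> interlace_opt z (o 2%N) -> interlace_opt z (o 3%N)) ->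
  (forall z k, z \in S -> (1 <= k < d)%N -> interlace_opt z (o k.+2) ->
    interlace_opt z (o k.+1) || interlace_opt z (o k.+3)) ->
  exists T X u f, @tors_complex T X u f /\ iso (X 0%N) (optM K (o 1%N)).
Proof.
move=> o0S oend gap con inj ex Sinj Sex.
have exact k : (k <= d)%N ->
    exact_at (optmap K (o k) (o k.+1)) (optmap K (o k.+1) (o k.+2)).
  move=> kd; apply: (exact_from_proj d_gt0); first exact: inM_optM.
    exact: (optmap_comp0 K d_gt0).
  by move=> z h z0; exact: (optmap_lift d_gt0 (con z k) (con z k.+1) (ex z k z0 kd)).
exists (optM K (o 0%N)), (fun k => optM K (o k.+1)), (optmap K (o 0%N) (o 1%N)),
  (fun k => optmap K (o k.+1) (o k.+2)); split; last exact: iso_refl.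
split.
- split; last by move=> k; apply: inM_optM.
  by move: o0S; case: (o 0%N) => [x|] oS; [apply: sums_Mx; apply: oS|apply: sums0].
- by rewrite oend; apply: iso_refl.
- split; last exact: exact.
  apply: (mono_from_proj d_gt0); first exact: inM_optM.
  move=> z h z0; apply: (optmap_inj d_gt0) => zo.
  by rewrite inj // (con z 0%N) // inj.
- by move=> k kd; apply: exact.
move=> z zS; split=> [h|k kd h]; last first.
  exact: (optmap_lift d_gt0 (con z k.+1) (con z k.+2) (Sex z k zS kd)).
by apply: (optmap_inj d_gt0) => zo; rewrite Sinj // (con z) // Sinj.
Qed.

End TorsionSequences.

Section Closed.
Variables (n d : nat).
Implicit Types (x y z b : os n d.+1) (S : {set os n d.+1}).

(* For S a set of images under [extend], [upclosed] is [order_filter] and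
   [extclosed] the other condition of [torclosed]. *)
Definition upclosed S := forall x y, x \in S ->
  (forall i, (i < d)%N -> (ent x i <= ent y i)%N) -> ent x d = ent y d -> y \in S.

Definition extclosed S := forall x b y, x \in S -> b \in S ->
  (forall i, (i < d)%N -> ent b i = (ent x d).+1) ->
  (forall i, (i < d)%N -> ent y i = ent x i) -> ent y d = ent b d -> y \in S.

Definition setlast x k : os n d.+1 :=
  os_of d.+1 (x ord0) (fun i => if (i < d)%N then ent x i else k).

Lemma ent_setlast x k i : (ent x d.-1 <= k < n)%N -> (i <= d)%N ->
  ent (setlast x k) i = if (i < d)%N then ent x i else k.
Proof.
move=> /andP[xk kn] id; apply: ent_os_of => // [l ld|l m lm md].
  by case: ifP => // ?; apply: ent_lt.
case: ifP => h1; case: ifP => h2 //; first exact: ent_mono; last by lia.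
by apply: leq_trans xk; apply: ent_mono; lia.
Qed.

Lemma setlast_last x : setlast x (ent x d) = x.
Proof.
apply: ent_inj => i id; rewrite ent_setlast //.
  by case: ifP => // ?; congr ent; lia.
by rewrite ent_lt // andbT ent_mono // leq_pred.
Qed.

(** Interlacing puts the first d entries of z below those of x, and x with its last entry changed to
    that of z stays sorted; so the changed sequence is above z in the same component. *)
Lemma setlast_in S x z : upclosed S -> z \in S -> interlace z x -> (0 < d)%N ->
  (ent x d.-1 <= ent z d <= ent x d)%N && (setlast x (ent z d) \in S).
Proof.
move=> Sup zS /interlaceP[h1 h2] d0.
have b : (ent x d.-1 <= ent z d <= ent x d)%N.
  by rewrite h1 // andbT; have := h2 d.-1; rewrite prednK //; apply; lia.
have b' : (ent x d.-1 <= ent z d < n)%N by case/andP: b => -> _; apply: ent_lt.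
rewrite b; apply: (Sup z) => //.
  by move=> i id; rewrite ent_setlast ?(ltnW id) // id h1 // ltnW.
by rewrite ent_setlast // ltnn.
Qed.

End Closed.

(** * Closed sets of indices give torsion classes *)

Section ClosedIsTorsion.
Variables (K : fieldType) (n d : nat).
Hypothesis d_gt0 : (0 < d)%N.
Variable S : {set os n d.+1}.
Hypotheses (Sup : upclosed S) (Sext : extclosed S).
Local Notation M := (@Mx K n d).

(* The conclusion is that M_z has no nonzero d-extension by M_a. *)
Lemma extclosed_res a j z : a \in S -> (ent a d < j)%N -> (j < n)%N ->
  (forall k, (ent a d < k <= j)%N -> setlast a k \notin S) ->
  z \in S -> interlace z (res a j d.+1) -> (ent z 0 <= ent a 0)%N.
Proof.
move=> aS aj jn max zS /interlaceP[h1 h2]; rewrite leqNgt; apply/negP => za.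
have zb i : (i < d)%N -> (ent z i <= (ent a d).+1)%N.
  move=> id; have := h1 i (ltnW id); rewrite ent_res ?(ltnW id) //=.
  rewrite (_ : (i + d < d)%N = false) ?id; last by lia.
  by have := ent_mono a (i := i.+1) (j := d) id (leqnn _); lia.
have zd : ((ent a d).+1 <= ent z d <= j)%N.
  have := h1 d (leqnn _); have := h2 d.-1; rewrite !ent_res /=; try lia.
  rewrite (_ : (d.-1 + d < d)%N = false) ?ltnn; last by lia.
  rewrite (_ : (d.-1 < d)%N) ?prednK; try lia.
  by case: ifP; lia.
(* These entries dominate those of z and share its last one, so their sequence is in S; extending a
   by it puts [setlast a (ent z d)] in S, against [max]. *)
pose f i := if (i < d)%N then (ent a d).+1 else ent z d.
have fE i : (i <= d)%N -> ent (os_of d.+1 (a ord0) f) i = f i.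
  move=> id; apply: ent_os_of => // [l ld|l m lm md]; rewrite /f;
  have := ent_lt z (i := d); by repeat case: ifP; lia.
have ak : (ent a d.-1 <= ent z d < n)%N.
  by have := @ent_mono _ _ a d.-1 d; rewrite ent_lt //; lia.
have /negP := max (ent z d) zd; apply.
apply: (Sext (x := a) (b := os_of d.+1 (a ord0) f)) => //.
- apply: (Sup zS) => [i id|]; rewrite fE /f ?ltnn ?id ?zb //; exact: ltnW.
- by move=> i id; rewrite fE /f ?id // ltnW.
- by move=> i id; rewrite ent_setlast ?id // ltnW.
by rewrite ent_setlast // fE // /f !ltnn.
Qed.

Lemma closed_tors_complex x : exists T X u f,
  @tors_complex K n d S T X u f /\ iso (X 0%N) (M x).
Proof.
pose P k := (ent x d.-1 <= k <= ent x d)%N && (setlast x k \in S).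
have [/existsP[k0 Pk0]|/existsPn noP] := boolP [exists k : 'I_n, P k]; last first.
  have Sx z : z \in S -> ~~ interlace z x.
    move=> zS; apply/negP => zx.
    have /negP := noP (Ordinal (ent_lt z (leqnn d.+1))); apply.
    exact: setlast_in.
  (* No nonzero map goes from S to M_x: the torsion subobject is 0 and V_1 is M_x. *)
  pose o k := if k is 0%N then None else if k is k'.+3 then None else Some x.
  apply: (tors_complex_opt K d_gt0 (o := o)) => //.
  - by have om m : (2 < m)%N -> o m = None; [case: m => [|[|[|]]]|apply: om].
  - by case=> [|[|[|k]]].
  - by move=> z [|[|[|k]]] //= _ _; apply: interlace_refl.
  - by move=> z [|[|k]] //= _ _ ->; rewrite ?orbT.
  - by move=> z /Sx /negPf /= ->.
  - by move=> z [|k].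
have exP : exists k, P k by exists k0.
have boundP k : P k -> (k <= ent x d)%N by case/andP => /andP[].
case: (ex_maxnP exP boundP) => k /andP[/andP[xk kx] aS] maxk.
have xn : (ent x d < n)%N by apply: ent_lt.
have Smax z : z \in S -> interlace z x -> (ent z d <= k)%N.
  by move=> zS zx; apply: maxk; apply: setlast_in.
move: kx; rewrite leq_eqVlt => /orP[/eqP kx|kx].
  have {}xS : x \in S by rewrite -(setlast_last x) -kx.
  (* M_x is its own torsion subobject and all V_i vanish. *)
  pose o k := if k is k.+2 then None else Some x.
  apply: (tors_complex_opt K d_gt0 (o := o)) => //.
  - by move=> _ [<-].
  - by case=> [|[|k']].
  - by move=> z [|[|k']] //= _ _; apply: interlace_refl.
  - by move=> z [|k'] //= _ _ ->.
set a := setlast x k in aS; set j := ent x d in kx.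
have ea i : (i <= d)%N -> ent a i = if (i < d)%N then ent x i else k.
  by move=> id; apply: ent_setlast => //; rewrite xk (leq_ltn_trans (ltnW kx)).
clearbody a; have aj : (ent a d < j)%N by rewrite ea // ltnn.
have r1 : res a j 1 = x.
  apply: ent_inj => i id; rewrite res1 //; case: ifP => h; first by rewrite ea ?h // ltnW.
  by congr ent; lia.
(* Maximality of k makes Hom(M_z, V_{d-1}) -> Hom(M_z, V_d) surjective, with V_0 = M_x. *)
have Srd z m : z \in S -> m = d -> interlace z (res a j m.+1) -> interlace z (res a j m).
  move=> zS -> zr; apply: interlace_res_last => //; apply: (extclosed_res aS aj) => //.
  move=> k'; rewrite ea // ltnn => /andP[kk' k'j]; apply/negP => Sk'.
  suff /maxk : P k' by lia.
  rewrite /P k'j andbT (leq_trans xk (ltnW kk')) /=.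
  rewrite (_ : setlast x k' = setlast a k') //.
  have xk' : (ent x d.-1 <= k' < n)%N by lia.
  have dd : (d.-1 < d)%N by lia.
  have ad : ent a d.-1 = ent x d.-1 by rewrite ea ?dd // ltnW.
  apply: ent_inj => i id; rewrite !ent_setlast ?ad //.
  by case: ifP => // h; rewrite ea ?h // ltnW.
(* Maximality of k also makes every map from M_z to M_x factor through M_a. *)
have Sr0 z : z \in S -> interlace z (res a j 1) -> interlace z (res a j 0).
  rewrite r1 res0 // => zS zx; have zk := Smax z zS zx.
  move/interlaceP: zx => [h1 h2]; apply/interlaceP; split=> i id; rewrite ea ?(ltnW id) //.
    by case: ifP => h; [apply: h1|rewrite (_ : i = d) //; lia].
  by rewrite id h2.
pose o k := if (k <= d.+1)%N then Some (res a j k) else None.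
rewrite -{1}r1 -[M _]/(optM K (o 1%N)); apply: (tors_complex_opt K d_gt0 (o := o)).
- by move=> y [<-]; rewrite res0.
- by rewrite /o ltnn.
- move=> i; rewrite /o; case: ifP => // h1; case: ifP => // h2 /=.
  by apply: interlace_res_gap; rewrite ?interlace_refl //; lia.
- move=> z i; rewrite /o; case: ifP => // h1; case: ifP => // h2 _ _ /=.
  exact: interlace_resS.
- move=> z z0 /=; rewrite res0 // r1 => /interlaceP[h1 h2].
  apply/interlaceP; split=> i id.
    by have := h1 i id; rewrite ea //; case: ifP => // h; rewrite (_ : i = d) /j; lia.
  by have := h2 i id; rewrite ea ?id // ltnW.
- move=> z i z0 id; rewrite /o ltnS id (leq_trans id (leqnSn _)) /=.
  move: id; rewrite leq_eqVlt => /orP[/eqP ->|id].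
    by move=> zr; rewrite interlace_res_last // z0.
  by rewrite ltnS id; apply: interlace_res_or.
- move=> z zS; rewrite /o !ltnS d_gt0 /= => z2.
  have n1 : ~~ interlace z (res a j 1).
    apply/negP => /(Sr0 z zS) z0.
    by have := interlace_res_gap d_gt0 aj xn d_gt0 z0; rewrite z2.
  (* For d = 1 the terms V_1 and V_d coincide, and [Srd] takes the place of the comparison with
     V_2. *)
  have [d1|d1] := leqP 2 d; last first.
    have dE : d = 1%N by lia.
    by case/negP: n1; apply: Srd.
  have := interlace_res_or d_gt0 aj xn d1 z2.
  by rewrite (negPf n1).
move=> z i zS /andP[i0 id]; rewrite /o !ltnS id (ltnW id) /=.
move: (id); rewrite leq_eqVlt => /orP[/eqP idE|id'].
  by move=> zr; rewrite (Srd z).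
by rewrite id'; apply: interlace_res_or.
Qed.

Lemma closed_dtorsion : dtorsion_class (@inM K n d) (sums S).
Proof.
split.
- by move=> V SV; apply/inM_sums/sumsS/SV => x; rewrite inE.
- split.
  + by move=> V W; apply: sums_iso.
  + exact: sums0.
  + exact: sums_dsum.
  + exact: sums_summand.
move=> N /inM_sums MN.
suff [T [X [u [f [t X0]]]]] :
    exists T X u f, @tors_complex K n d S T X u f /\ iso (X 0%N) N.
  exact: (tors_complex_torsion_seq t X0).
move: N MN; apply: sums_ind.
- move=> V W VW [T [X [u [f [t X0]]]]]; exists T, X, u, f; split=> //.
  exact: iso_trans X0 VW.
- pose o (k : nat) : option (os n d.+1) := None.
  exact: (tors_complex_opt K d_gt0 (o := o)).
- by move=> x _; apply: closed_tors_complex.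
move=> V W [T [X [u [f [t X0]]]]] [T' [X' [u' [f' [t' X0']]]]].
exists (dsum T T'), (fun k => dsum (X k) (X' k)), (hdsum u u'),
  (fun k => hdsum (f k) (f' k)); split; first exact: tors_complex_dsum.
exact: iso_dsum.
Qed.

Lemma index_set_sums : index_set (sums (K := K) S) = S.
Proof.
apply/setP => x; rewrite inE; apply/asboolP/idP => [|/sums_Mx //].
exact: sums_Mx_in.
Qed.

End ClosedIsTorsion.

(** * Closure properties of torsion classes *)

Section Lifting.
Variables (K : fieldType) (n d : nat).
Hypothesis d_gt0 : (0 < d)%N.
Local Notation M := (@Mx K n d).

(** An embedding is nonzero at the socle vertex of M_z, which therefore lies in the support of
    M_w. *)
Lemma mono_ent_ge z w (h : hom (M z) (M w)) : mono h ->
  forall i, (i < d)%N -> (ent w i <= ent z i)%N.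
Proof.
move=> mh; have sw : msupp w (soc z).
  apply/negP => /negP nsw; have /lker0P inj : lker (h (soc z)) == 0%VS by apply/eqP/mh.
  have /eqP := const_mx1_neq0 K (msupp_soc z); apply; apply: inj.
  by rewrite hom_to_off_supp // !lfunE.
by move=> i id; have /msuppP/(_ i id) := sw; rewrite ent_soc // => /andP[].
Qed.

Lemma mono_comp_split (V W X : rep K n d) (u : hom W X) (i : hom V W) (p : hom W V) :
  mono u -> p ** i = hid V -> mono (u ** i : hom V X).
Proof.
move=> mu pi y; apply/eqP/lker0P => a b; rewrite !hcompE.
have /lker0P inj : lker (u y) == 0%VS by apply/eqP/mu.
by move/inj/(congr1 (p y)); rewrite -!hcompE pi /= !lfunE.
Qed.

Section Contravariant.
Variables (a : os n d.+1) (j : nat).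
Hypotheses (aj : (ent a d < j)%N) (jn : (j < n)%N).

Definition resmap k : hom (M (res a j k)) (M (res a j k.+1)) := cmap K _ _.

Lemma resmap_comp0 k : (k < d)%N -> resmap k.+1 ** resmap k = 0.
Proof.
move=> kd; apply: (hom_interlace0 d_gt0).
by apply: interlace_res_gap; rewrite ?interlace_refl.
Qed.

(** Hom(-, X) keeps the complex exact at its inner terms: for X = M_w by [res_interlace_or], for
    sums componentwise. *)
Lemma resmap_lift k X (h : hom (M (res a j k.+1)) X) : (k < d)%N -> inM X ->
  h ** resmap k = 0 -> exists h', h = h' ** resmap k.+1.
Proof.
move=> kd /inM_sums XM; move: X XM h; apply: sums_ind.
- move=> V W /isoP[p [q [qp pq]]] VP h h0.
  have [|h' hh'] := VP (q ** h); first by rewrite -hcompA h0 hcomp0r.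
  by exists (p ** h'); rewrite -hcompA -hh' hcompA pq hcomp1l.
- by move=> h _; exists 0; rewrite hcomp0l [h]hom_rzero_r.
- move=> w _ h h0; have [rw|nrw] := boolP (interlace (res a j k.+1) w); last first.
    by exists 0; rewrite hcomp0l; apply: hom_interlace0.
  have [c hc] := hom_cmap d_gt0 h.
  have [rw'|nrw'] := boolP (interlace (res a j k) w).
    exists 0; rewrite hcomp0l hc; move: h0; rewrite hc hcompZl.
    rewrite cmap_comp ?interlace_resS // => /eqP.
    by rewrite scaler_eq0 => /orP[/eqP ->|/eqP/(cmap_neq0 d_gt0 rw')//]; rewrite scale0r.
  have rw'' : interlace (res a j k.+2) w.
    by have := res_interlace_or d_gt0 aj jn kd rw; rewrite (negPf nrw').
  by exists (c *: cmap K _ w); rewrite hc hcompZl cmap_comp ?interlace_resS.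
move=> V W VP WP h h0.
have [|g hg] := VP (hfst V W ** h); first by rewrite -hcompA h0 hcomp0r.
have [|g' hg'] := WP (hsnd V W ** h); first by rewrite -hcompA h0 hcomp0r.
exists (hinl V W ** g + hinr V W ** g').
by rewrite hcompDl -!hcompA -hg -hg' -hom_to_dsumE.
Qed.

End Contravariant.
End Lifting.

Section TorsionIsClosed.
Variables (K : fieldType) (n d : nat).
Hypothesis d_gt0 : (0 < d)%N.
Local Notation M := (@Mx K n d).
Variable U : rep K n d -> Prop.
Hypothesis Utors : dtorsion_class (@inM K n d) U.
Local Notation S := (index_set U).

Lemma index_setP x : reflect (U (M x)) (x \in S).
Proof. by rewrite inE; apply: asboolP. Qed.

Lemma torsion_class_sums V : U V <-> sums S V.
Proof.
have [UM [Uiso U0 Udsum Usummand] _] := Utors; split=> [UV|].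
  have [s Vs] := UM V UV; exists s => //.
  have := Uiso _ _ Vs UV; elim: s {Vs} => //= x s ih Us z.
  rewrite inE => /orP[/eqP ->|]; first exact/index_setP/(Usummand _ _ Us).
  by apply: ih; apply: Usummand; apply: Uiso Us; apply: iso_dsumC.
by apply: sums_ind => // x /index_setP.
Qed.

(** The composite W -> N -> V_1 is killed by V_1 -> V_2, and Hom(W, V_1) -> Hom(W, V_2) is
    injective; so the composite is 0 and W maps into the torsion subobject. *)
Lemma torsion_approx N UM V u f : @torsion_seq K n d (@inM K n d) U N UM V u f ->
  forall W, U W -> forall h : hom W N, exists g, h = u ** g.
Proof.
move=> [_ _ _ [mu exu exf] hex] W UW h.
apply: (mono_exact_lift mu exu); have [inj _] := hex W UW; apply: hom_ext.
apply: inj => y; rewrite (_ : f 1%N ** (f 0%N ** h) = 0) // hcompA.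
by rewrite (exact_comp0 (exf 0%N d_gt0)) hcomp0l.
Qed.

(* A nonzero morphism to M_x through the torsion subobject of M_x passes
   through some M_z in U that differs from M_x at most in the last entry. *)
Lemma torsion_factor x UM A (u : hom UM (M x)) (g : hom A UM) :
  U UM -> mono u -> u ** g <> 0 -> exists z, [/\ z \in S,
    forall i, (i < d)%N -> ent z i = ent x i, (ent z d <= ent x d)%N &
    exists h : hom UM (M z), h ** g <> 0].
Proof.
move=> /torsion_class_sums SUM mu ug.
have [z zS [i [p [pi /comp_neq0[ui pg]]]]] := sums_factor SUM ug.
exists z; have zx := hom_neq0_interlace d_gt0 ui; have [h1 _] := interlaceP _ _ zx.
split=> //; [|exact: h1|by exists p].
move=> k kd; apply/eqP; rewrite eqn_leq h1 ?(ltnW kd) //.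
exact: (mono_ent_ge (mono_comp_split mu pi)).
Qed.

(** The canonical map factors through the torsion subobject of M_x', so some z in S agrees with x'
    off the last entry, where x <= z <= x' leaves only equality. *)
Lemma torsion_interlace_closed x x' : x \in S -> interlace x x' ->
  ent x d = ent x' d -> x' \in S.
Proof.
move=> xS xx' exx'; have [_ _ tors] := Utors.
have [|UM [V [u [f t]]]] := tors (M x').
  by apply/inM_sums/sums_Mx; rewrite inE.
have [g hg] := torsion_approx t (elimT (index_setP x) xS) (cmap K x x').
have [[_ UUM] _ _ [mu _ _] _] := t.
have [|z [zS ez lez [h hg0]]] := torsion_factor UUM mu (g := g).
  by rewrite -hg; apply: cmap_neq0.
have /interlaceP[/(_ d (leqnn d)) xz _] := hom_neq0_interlace d_gt0 hg0.
suff -> : x' = z by [].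
apply: ent_inj => i; rewrite ltnS leq_eqVlt => /orP[/eqP ->|/ez //].
by apply/eqP; rewrite eqn_leq lez andbT -exx' xz.
Qed.

Lemma torsion_upclosed : upclosed S.
Proof.
(* [t m] has the first m entries of x and then those of y. Replacing entries one at a time from the
   right makes consecutive sequences interlace. *)
move=> x y xS xy exy; pose f m i := if (i < m)%N then ent x i else ent y i.
pose t m := os_of d.+1 (x ord0) (f m).
have et m i : (i <= d)%N -> ent (t m) i = f m i.
  move=> id; apply: ent_os_of => // [k kd|k l kl ld]; rewrite /f.
    by case: ifP => _; apply: ent_lt.
  case: ifP => h1; case: ifP => h2; try exact: ent_mono; last by lia.
  apply: leq_trans (ent_mono x kl ld) _; have [->|ne] := eqVneq l d.
    by rewrite exy.
  by apply: xy; lia.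
suff tS m : (m <= d)%N -> t (d - m)%N \in S.
  have := tS d (leqnn d); rewrite subnn; suff -> : t 0%N = y by [].
  by apply: ent_inj => i id; rewrite et.
elim: m => [|m ih] md.
  rewrite subn0; suff -> : t d = x by [].
  apply: ent_inj => i id; rewrite et // /f; case: ifP => // h.
  by rewrite (_ : i = d) //; lia.
apply: torsion_interlace_closed (ih (ltnW md)) _ _; last first.
  by rewrite !et // /f !ltnNge !leq_subr.
apply/interlaceP; split=> i id; rewrite !et // /f; try exact: ltnW.
  case: ifP => h1; case: ifP => h2 //; last by lia.
  by have [->|ne] := eqVneq i d; [rewrite exy|apply: xy; lia].
case: ifP => h1; case: ifP => h2; try exact: ent_mono; last by lia.
by apply: leq_trans (xy i id) _; lia.
Qed.

(** * Comparison of a torsion sequence with a projective resolution *)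

Section Chase.
Variables (x a : os n d.+1) (j : nat) (UM : rep K n d) (V : nat -> rep K n d).
Variables (u : hom UM (M x)).
Variables (f : forall k, hom (seq_from (M x) V k) (seq_from (M x) V k.+1)).
Hypotheses (t : torsion_seq (@inM K n d) U u f) (a0 : ent a 0 = 0%N).
Hypotheses (aj : (ent a d < j)%N) (jn : (j < n)%N) (zS : res a j d.+1 \in S).
Local Notation X := (seq_from (M x) V).

Let inMX k : (k <= d)%N -> inM (X k).
Proof.
case: k => [|k] kd; last by have [_ C _ _ _] := t; apply: (C k.+1).
by apply/inM_sums/sums_Mx; rewrite inE.
Qed.

(** Hom-exactness at V_d, where the next term is 0. For d = 1 it amounts to Hom(M_z, V_1) = 0. *)
Let lift_last z q : z \in S -> q.+1 = d -> forall h : hom (M z) (X q.+1),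
  exists s : hom (M z) (X q), h = f q ** s.
Proof.
move=> zinS qd h; have [_ _ X0 _ hex] := t.
have {hex}[inj ex] := hex _ (elimT (index_setP _) zinS).
have [i [p [pi _]]] : exists (i : hom (X d.+1) (rzero K n d))
    (p : hom (rzero K n d) (X d.+1)), p ** i = hid _ /\ i ** p = hid _ by apply/isoP.
have to0 (g : hom (M z) (X d.+1)) : g = 0.
  by rewrite -[g]hcomp1l -pi -hcompA [_ ** g]hom_rzero_r hcomp0r.
have fh : f q.+1 ** h = 0 by move: (f q.+1 ** h); rewrite qd.
case: q qd h fh => [|q] qd h fh.
  by exists 0; rewrite hcomp0r; apply: hom_ext; apply: inj => y; rewrite fh.
have qd' : (1 <= q.+1 < d)%N by lia.
have [|g /hom_ext <-] := (ex q.+1 qd' h).1; last by exists g.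
by move=> y; rewrite fh.
Qed.

(* The rows are V_0 = M_x, V_1, ..., V_d, the columns the terms of the resolution:
   h extends one step to V_{q+1}, induction applies there, and projectivity brings
   the correction back to V_q; Hom-exactness at V_d starts the induction. *)
Lemma torsion_chase q : (q < d)%N -> forall h : hom (M (res a j q.+1)) (X q),
  f q ** h ** resmap K a j q = 0 ->
  exists s : hom (M (res a j q.+2)) (X q), f q ** (h - s ** resmap K a j q.+1) = 0.
Proof.
have [_ _ _ [_ _ exf] _] := t.
have [m] := ubnP (d - q); elim: m q => // m ih q qm qd h fh0.
have [h1 hh1] := resmap_lift d_gt0 aj jn qd (inMX qd) fh0.
have [qd1|qd1] := eqVneq q.+1 d.
  have [s hs] : exists s : hom (M (res a j q.+2)) (X q), h1 = f q ** s.
    by apply: lift_last => //; rewrite qd1.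
  by exists s; rewrite hcompBr hcompA -hs -hh1 subrr.
have {}qd1 : (q.+1 < d)%N by lia.
have [||s1 fs1] := ih q.+1 _ qd1 h1; first by lia.
  by rewrite -hcompA -hh1 hcompA (exact_comp0 (exf q qd)) hcomp0l.
(* Before the last column every first entry is [ent a 0] = 0, so this column is projective. *)
have r0 : ent (res a j q.+2) 0 = 0%N by rewrite ent_res //= add0n qd1.
have [s hs] := proj_lift (inMX (ltnW qd)) r0 (exf q qd) fs1.
exists s; rewrite hcompBr (hcompA _ s) -hs hcompBl -hh1 -hcompA.
by rewrite resmap_comp0 // hcomp0r subr0 subrr.
Qed.

End Chase.

(** The chase corrects the canonical map to M_x so that it lands in the torsion subobject, without
    changing it on the first column. The last entry j of its source then forces the summand given by
    [torsion_factor] to be M_x. *)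
Lemma torsion_res a j : (ent a d < j)%N -> (j < n)%N -> a \in S ->
  res a j d.+1 \in S -> res a j 1 \in S.
Proof.
move=> aj jn aS zS; set x := res a j 1.
have ex i : (i <= d)%N -> ent x i = if (i < d)%N then ent a i else j.
  by move=> id; rewrite res1.
(* With first entry 0 all columns but the last become projective; the last does not involve
   [ent a 0], so it stays in S. *)
pose a0 := os_of d.+1 (a ord0) (fun i => if i is i'.+1 then ent a i else 0%N).
have ea0 i : (i <= d)%N -> ent a0 i = if i is i'.+1 then ent a i else 0%N.
  move=> id; apply: ent_os_of => // [[|k] kd|[|k] [|l] kl ld] //.
  - by have := ent_lt a kd; lia.
  - exact: ent_lt.
  - exact: ent_mono.
have a0d : ent a0 d = ent a d.
  suff e i : (0 < i <= d)%N -> ent a0 i = ent a i by rewrite e // d_gt0 /=.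
  by move=> id; rewrite ea0; case: i id; try lia.
have a0j : (ent a0 d < j)%N by rewrite a0d.
have zE : res a0 j d.+1 = res a j d.+1.
  apply: ent_inj => i id; rewrite !ent_res //=; case: ifP => [|_]; first by lia.
  by case: ifP => // h; rewrite ea0.
have [_ _ tors] := Utors.
have [|UM [V [u [f t]]]] := tors (M x).
  by apply/inM_sums/sums_Mx; rewrite inE.
have [[_ UUM] _ _ [mu exu _] _] := t.
have am i : (i < d)%N -> (ent a i <= ent a i.+1)%N by move=> id; apply: ent_mono.
have i1 : interlace (res a0 j 1) x.
  apply/interlaceP; split=> i id.
    by rewrite res1 // ex //; case: ifP => // h; rewrite ea0 //; case: i id h.
  rewrite ex ?(ltnW id) // id res1 //; case: ifP => h; first by rewrite ea0 // am.
  by have := am i id; rewrite (_ : i.+1 = d); lia.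
have i2 : interlace a0 a.
  apply/interlaceP; split=> i id; rewrite ea0 //; last exact: am.
  by case: i id.
have i3 : interlace a x by rewrite -(res0 d_gt0 aj jn); apply: interlace_resS.
have i4 : interlace a0 x.
  apply/interlaceP; split=> i id.
    rewrite ex // ea0 //; case: i id => [|i] // id.
    by case: ifP => // h; rewrite (_ : i.+1 = d) ?(ltnW aj) //; lia.
  by rewrite ex ?(ltnW id) // id ea0 // am.
have [g hg] := torsion_approx t (elimT (index_setP a) aS) (cmap K a x).
(* On M_a0 the map goes through M_a, which is in U, hence through the torsion subobject, which [f 0]
   kills. *)
have fc : f 0%N ** cmap K (res a0 j 1) x ** resmap K a0 j 0 = 0.
  rewrite -hcompA cmap_comp ?interlace_resS // (res0 d_gt0 a0j jn) //.
  by rewrite -(cmap_comp K d_gt0 i2 i3 i4) hg !hcompA (exact_comp0 exu) !hcomp0l.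
have zS0 : res a0 j d.+1 \in S by rewrite zE.
have a00 : ent a0 0 = 0%N by rewrite ea0.
have [s fs] := torsion_chase t a00 a0j jn zS0 d_gt0 fc.
have [e he] := mono_exact_lift mu exu fs.
(* The correction by [s] vanishes on M_a0, so [u ** e] still restricts there to the nonzero
   canonical map. *)
have ue : u ** (e ** resmap K a0 j 0) <> 0.
  rewrite hcompA -he hcompBl -(hcompA s) resmap_comp0 // hcomp0r subr0.
  rewrite cmap_comp ?interlace_resS // (res0 d_gt0 a0j jn) //.
  exact: cmap_neq0.
have [z [zinS ez lez [h /[!hcompA]/comp_neq0[he0 _]]]] := torsion_factor UUM mu ue.
have /interlaceP[/(_ d (leqnn d)) le _] := hom_neq0_interlace d_gt0 he0.
suff -> : x = z by [].
apply: ent_inj => i; rewrite ltnS leq_eqVlt => /orP[/eqP ->|/ez //].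
apply/eqP; rewrite eqn_leq lez andbT; move: le.
by rewrite res1 // ex // ltnn.
Qed.

Lemma torsion_extclosed : extclosed S.
Proof.
move=> x b y xS bS eb ey eyd; set j := ent b d in eyd.
have jn : (j < n)%N by apply: ent_lt.
have xj : (ent x d < j)%N by rewrite -ltnS -(eb 0%N) // ltnS ent_mono.
(* From index m on, the entries of a equal [ent x d]. The induction starts at the constant sequence,
   for which the last term of the resolution is b. *)
suff main m : forall a, a \in S -> ent a d = ent x d ->
    (forall i, (m <= i < d)%N -> ent a i = ent x d) -> res a j 1 \in S.
  suff -> : y = res x j 1 by apply: (main d) => // i; lia.
  apply: ent_inj => i id; rewrite res1 //; case: ifP => h; first exact: ey.
  by rewrite -eyd; congr ent; lia.
elim: m => [|m ih] a aS ead ea; have aj : (ent a d < j)%N by rewrite ead.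
  apply: torsion_res => //; suff -> : res a j d.+1 = b by [].
  apply: ent_inj => i id; rewrite ent_res //=; case: ifP => [|_]; first by lia.
  case: ifP => h; last by rewrite /j; congr ent; lia.
  rewrite eb //; congr _.+1; have [->//|ne] := eqVneq i.+1 d.
  by apply: ea; lia.
(* The sequence c below also raises entry m to [ent x d], so the induction hypothesis applies to
   it. *)
pose f i := if (i < m)%N then ent a i else ent x d.
have am i l : (i <= l)%N -> (l <= d)%N -> (ent a i <= ent a l)%N.
  by move=> il ld; apply: ent_mono.
have ec i : (i <= d)%N -> ent (os_of d.+1 (a ord0) f) i = f i.
  move=> id; apply: ent_os_of => // [l ld|l k lk kd]; rewrite /f.
    by case: ifP => _; apply: ent_lt.
  have := am l k lk kd; have := am l d.
  by case: ifP => h1; case: ifP => h2; lia.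
set c := os_of _ _ _ in ec.
have cS : c \in S.
  apply: (torsion_upclosed aS) => [i id|]; rewrite ec /f //; try exact: ltnW.
    by case: ifP => // _; have := am i d; lia.
  by case: ifP => // h; have := am d m; lia.
have cd : ent c d = ent x d.
  by rewrite ec // /f; case: ifP => // h; have := ea d; lia.
have rS : res c j 1 \in S.
  by apply: ih => // i /andP[mi id]; rewrite ec ?(ltnW id) // /f ltnNge mi.
have cj : (ent c d < j)%N by rewrite cd.
(* [res a j d.+1] dominates [res c j 1] and has the same last entry j. *)
apply: torsion_res => //; apply: (torsion_upclosed rS) => [i id|].
  have id' := ltnW id; rewrite res1 // id ec // ent_res //= id.
  rewrite (_ : (i + d < d)%N = false); last by lia.
  rewrite /f; case: ifP => h; first by apply/leqW/am.
  have [e|ne] := eqVneq i.+1 d; first by rewrite e; lia.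
  by rewrite ea; lia.
by rewrite res1 // ent_res //= ltnn (_ : (d + d < d)%N = false) //; lia.
Qed.


End TorsionIsClosed.

(** * Torclosed sets *)

Section Extend.
Variables (n d : nat) (d_gt0 : (0 < d)%N).
Local Notation C := (cposet (diag n d_gt0)).

Lemma ent_extend (c : C) i : (i <= d)%N ->
  ent (extend c) i = if (i < d)%N then ent (val c).1 i else (val c).2.
Proof.
move=> id; rewrite /ent /= map_rcons nth_rcons size_map size_tuple.
case: ltnP => // di; suff -> : i == d by [].
by rewrite eqn_leq id.
Qed.

Lemma extend_surj (x : os n d.+1) : exists c : C, extend c = x.
Proof.
have ef i : (i < d)%N -> ent (os_of d (x ord0) (ent x)) i = ent x i.
  move=> id; apply: ent_os_of => // [k kd|k l kl ld].
    by apply: ent_lt; apply: ltnW.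
  by apply: ent_mono => //; apply: ltnW.
have le : (os_of d (x ord0) (ent x) <= diag n d_gt0 (x ord_max))%O.
  apply/forallP => i; rewrite diagE !entryE ef // ent_mono //.
  exact: ltnW.
exists (exist _ (os_of d (x ord0) (ent x), x ord_max) le).
apply: ent_inj => i id; rewrite ent_extend //=; case: ifP => h; first exact: ef.
by rewrite entryE; congr ent => /=; lia.
Qed.

Lemma le_cposet_extend (a b : C) : le_cposet a b <->
  (forall i, (i < d)%N -> (ent (extend a) i <= ent (extend b) i)%N) /\
  ent (extend a) d = ent (extend b) d.
Proof.
split=> [/andP[/eqP e /forallP le]|[le e]].
  split=> [i id|]; rewrite !ent_extend ?(ltnW id) ?ltnn ?e // id.
  by have := le (Ordinal id); rewrite !entryE.
apply/andP; split; first by rewrite -val_eqE; move: e => /eqP; rewrite !ent_extend ?ltnn.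
apply/forallP => i; have id := ltn_ord i; have := le i id.
by rewrite !ent_extend ?(ltnW id) // id !entryE.
Qed.

Lemma closed_torclosed (F : {set C}) :
  torclosed F <-> upclosed [set extend c | c in F] /\ extclosed [set extend c | c in F].
Proof.
have inj : injective (@extend n d d_gt0).
  move=> a b /(congr1 (@ent n d.+1)) e; apply: val_inj; rewrite [LHS]surjective_pairing.
  rewrite [RHS]surjective_pairing; congr pair.
    apply: ent_inj => i id; have := congr1 (fun f => f i) e.
    by rewrite /= !ent_extend ?id ?(ltnW id).
  apply: val_inj; have := congr1 (fun f => f d) e.
  by rewrite /= !ent_extend // ltnn.
split=> [[fil ext]|[up ext]]; split.
- move=> _ y /imsetP[a aF ->] le e; have [b yE] := extend_surj y; rewrite -{}yE in le e *.
  by apply/imset_f/(fil a) => //; apply/le_cposet_extend.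
- move=> _ _ y /imsetP[a aF ->] /imsetP[b bF ->] eb ey eyd.
  have [c yE] := extend_surj y; rewrite -{}yE in ey eyd *; apply: imset_f.
  (* The first d entries of b all equal [(val a).2] + 1, so any of them gives the k for which the
     first part of b is the k-th chain element. *)
  have i0 : (0 < d)%N := d_gt0; pose k := (val b).1 (Ordinal i0).
  have kE : k = (val a).2.+1 :> nat.
    by have := eb _ i0; rewrite !ent_extend ?i0 ?ltnn // entryE.
  apply: (ext (val a).2 (val b).2 k (val a).1 a b c) => //.
  + by rewrite -kE; have /forallP/(_ (Ordinal i0)) := valP b; rewrite diagE.
  + by case: (val a).
  + rewrite [LHS]surjective_pairing; congr pair; apply: osP => i; rewrite diagE kE.
    have id := ltn_ord i; have := eb i id.
    by rewrite !ent_extend ?(ltnW id) // id ltnn entryE.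
  + rewrite [LHS]surjective_pairing; congr pair.
      apply: osP => i; have id := ltn_ord i; have := ey i id.
      by rewrite !ent_extend ?(ltnW id) // id !entryE.
    by apply: val_inj; move: eyd; rewrite !ent_extend // ltnn.
- move=> a b aF /le_cposet_extend[le e]; rewrite -(mem_imset _ _ inj).
  by apply: up le e; apply: imset_f.
move=> i j k x a b c ij ki ea eb ec aF bF; rewrite -(mem_imset _ _ inj).
apply: (ext (extend a) (extend b)); try exact: imset_f.
- move=> l ld; rewrite !ent_extend ?ld ?ltnn ?(ltnW ld) // ea eb /= -ki.
  by rewrite -(entryE _ (Ordinal ld)) diagE.
- by move=> l ld; rewrite !ent_extend ?ld ?(ltnW ld) // ea ec.
by rewrite !ent_extend ?ltnn // eb ec.
Qed.

Lemma image_Tam (S : {set os n d.+1}) :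
  reflect (upclosed S /\ extclosed S)
          (S \in [set [set extend c | c in F] | F : {set C} in Tam (diag n d_gt0)]).
Proof.
apply: (iffP imsetP) => [[F]|SC].
  by rewrite inE => /asboolP/closed_torclosed SF ->.
have SE : S = [set extend c | c in [set c : C | extend c \in S]].
  apply/setP => x; apply/idP/imsetP => [xS|[c]]; last by rewrite inE => cS ->.
  by have [c xE] := extend_surj x; exists c; rewrite ?inE xE.
exists [set c : C | extend c \in S] => //; rewrite inE; apply/asboolP.
by apply/closed_torclosed; rewrite -SE.
Qed.

End Extend.

Theorem theorem5p5 (K : fieldType) (n d : nat) (n_gt0 : (0 < n)%N)
    (d_gt0 : (0 < d)%N) :
  (forall U U' : rep K n d -> Prop, dtorsion_class (@inM K n d) U -> 
     dtorsion_class (@inM K n d) U' ->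
     (forall V, U V -> U' V) <-> index_set U \subset index_set U') /\
  dtors_sets K n d =
    [set [set extend c | c in F] | F : {set cposet (diag n d_gt0)}
       in Tam (diag n d_gt0)].
Proof.
split=> [U U' Ut Ut'|].
  split=> [UU'|/subsetP UU' V]; first by apply/subsetP => x /index_setP/UU'/index_setP.
  by move=> /(torsion_class_sums Ut) UV; apply/(torsion_class_sums Ut')/(sumsS UU').
apply/setP => S; apply/idP/image_Tam => [|[Sup Sext]]; rewrite inE.
  move=> /asboolP[U Ut <-]; split; first exact: torsion_upclosed.
  exact: torsion_extclosed.
apply/asboolP; exists (sums S); first exact: closed_dtorsion.
exact: index_set_sums.
Qed.
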